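(* Let $M$ be an abelian monoid. Then $M$ is (isomorphic to) a direct limit of monoids each of which is a finite direct sum of abelian monoids of the form $(\mathbb{Z}/n\mathbb{Z})\sqcup\{0\}$, where $n\in\mathbb{N}$, or $\mathbb{Z}\sqcup\{0\}$, if and only if $M$ is a regular conical refinement monoid satisfying the embedding condition (emb) and the purity condition (pur).
   Context: $\mathbb{N}$ denotes the positive integers. For an abelian group $A$, $A\sqcup\{0\}$ denotes the abelian monoid obtained by adjoining to $A$ a new zero element (disjoint union); the old zero of $A$ becomes a nonzero idempotent. Direct limits are taken over directed systems in the category of abelian monoids (written additively) and monoid homomorphisms. An abelian monoid $M$ is preordered by: $x\le y$ iff there is $z\in M$ with $x+z=y$. $M$ is conical if $x+y=0$ implies $x=y=0$ for all $x,y\in M$. $M$ is regular if $2x\le x$ for all $x\in M$. $M$ is a refinement monoid if for all $a_0,a_1,b_0,b_1\in M$ with $a_0+a_1=b_0+b_1$ there are $c_{i,j}\in M$ ($i,j<2$) with $a_i=c_{i,0}+c_{i,1}$ and $b_i=c_{0,i}+c_{1,i}$ for $i<2$. Put $\Lambda(M)=\{x\in M: 2x=x\}$. For $e\in\Lambda(M)$ put $G_M[e]=\{x\in M: e\le x\le e\}$; for a regular abelian monoid $M$ each $G_M[e]$ is a subsemigroup of $M$ that is a group (with zero element $e$), and $M$ is the disjoint union of the $G_M[e]$, $e\in\Lambda(M)$. For $a\le b$ in $\Lambda(M)$, let $j_{a,b}\colon G_M[a]\to G_M[b]$, $x\mapsto x+b$; it is a group homomorphism. (emb): $j_{a,b}$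 is injective for all $a\le b$ in $\Lambda(M)$. (pur): the range of $j_{a,b}$ is a pure subgroup of $G_M[b]$ for all $a\le b$ in $\Lambda(M)$. *)

(* Defs.v *)
From HB Require Import structures.
From mathcomp Require Import all_boot all_order all_algebra.
From mathcomp Require Import boolp classical_sets functions.

Set Implicit Arguments.
Unset Strict Implicit.
Unset Printing Implicit Defensive.

Import GRing.Theory.

Local Open Scope classical_set_scope.
Local Open Scope ring_scope.

(* [adjoin_zero A] is the monoid obtained from the abelian group A by adjoining
   a new zero: the new zero is [None], the old one is the idempotent [Some 0]. *)
Definition adjoin_zero (A : zmodType) : Type := option A.

Section AdjoinZero.
Variable A : zmodType.

HB.instance Definition _ := Choice.on (adjoin_zero A).

Definition adjoin_zero_add (x y : adjoin_zero A) : adjoin_zero A :=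
  match x, y with
  | None, _ => y
  | _, None => x
  | Some a, Some b => Some (a + b)
  end.

Fact adjoin_zero_addA : associative adjoin_zero_add.
Proof. by move=> [a|] [b|] [c|] //=; rewrite addrA. Qed.

Fact adjoin_zero_addC : commutative adjoin_zero_add.
Proof. by move=> [a|] [b|] //=; rewrite addrC. Qed.

Fact adjoin_zero_add0 : left_id None adjoin_zero_add.
Proof. by []. Qed.

HB.instance Definition _ := GRing.isNmodule.Build (adjoin_zero A)
  adjoin_zero_addA adjoin_zero_addC adjoin_zero_add0.

End AdjoinZero.

Definition direct_sum (k : nat) (T : 'I_k -> nmodType) : Type :=
  {dffun forall i : 'I_k, T i}.

Section DirectSum.
Variables (k : nat) (T : 'I_k -> nmodType).

HB.instance Definition _ := Choice.on (direct_sum T).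

Definition direct_sum_zero : direct_sum T := [ffun i => (0 : T i)].

Definition direct_sum_add (x y : direct_sum T) : direct_sum T :=
  [ffun i => (x i + y i : T i)].

Fact direct_sum_addA : associative direct_sum_add.
Proof. by move=> x y z; apply/ffunP=> i; rewrite !ffunE addrA. Qed.

Fact direct_sum_addC : commutative direct_sum_add.
Proof. by move=> x y; apply/ffunP=> i; rewrite !ffunE addrC. Qed.

Fact direct_sum_add0 : left_id direct_sum_zero direct_sum_add.
Proof. by move=> x; apply/ffunP=> i; rewrite !ffunE add0r. Qed.

HB.instance Definition _ := GRing.isNmodule.Build (direct_sum T)
  direct_sum_addA direct_sum_addC direct_sum_add0.

End DirectSum.

Definition nmod_isomorphic (M N : nmodType) : Prop :=
  exists f : {additive M -> N}, bijective f.

(* Z/nZ for positive n is ['I_n'.+1] with n = n'.+1, so that Z/1Z is trivial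
   (which it would not be with ['Z_n]). *)
Definition basic_monoid (N : nmodType) : Prop :=
  (exists n : nat, nmod_isomorphic N (adjoin_zero 'I_n.+1))
  \/ nmod_isomorphic N (adjoin_zero int).

Definition finite_sum_of_basic (N : nmodType) : Prop :=
  exists (k : nat) (T : 'I_k -> nmodType),
    (forall i, basic_monoid (T i)) /\ nmod_isomorphic N (direct_sum T).

Definition directed (disp : Order.disp_t) (I : preorderType disp) : Prop :=
  (exists i : I, True)
  /\ forall i j : I, exists k : I, (i <= k)%O /\ (j <= k)%O.

Record direct_system (disp : Order.disp_t) (I : preorderType disp) := {
  ds_obj :> I -> nmodType;
  ds_map : forall i j : I, (i <= j)%O -> {additive ds_obj i -> ds_obj j};
  ds_map_id : forall (i : I) (hii : (i <= i)%O) (x : ds_obj i),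
    ds_map hii x = x;
  ds_map_comp : forall (i j k : I) (hij : (i <= j)%O) (hjk : (j <= k)%O)
      (hik : (i <= k)%O) (x : ds_obj i),
    ds_map hjk (ds_map hij x) = ds_map hik x
}.

Definition is_cocone (disp : Order.disp_t) (I : preorderType disp)
    (S : direct_system I) (N : nmodType)
    (g : forall i : I, {additive S i -> N}) : Prop :=
  forall (i j : I) (hij : (i <= j)%O) (x : S i), g j (ds_map S hij x) = g i x.

Definition is_colimit (disp : Order.disp_t) (I : preorderType disp)
    (S : direct_system I) (M : nmodType)
    (f : forall i : I, {additive S i -> M}) : Prop :=
  is_cocone f /\
  forall (N : nmodType) (g : forall i : I, {additive S i -> N}), is_cocone g ->
    exists h : {additive M -> N},
      (forall (i : I) (x : S i), h (f i x) = g i x) /\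
      forall h' : {additive M -> N},
        (forall (i : I) (x : S i), h' (f i x) = g i x) -> h' =1 h.

Definition is_direct_limit_of (P : nmodType -> Prop) (M : nmodType) : Prop :=
  exists (disp : Order.disp_t) (I : preorderType disp) (S : direct_system I)
      (f : forall i : I, {additive S i -> M}),
    [/\ directed I, forall i : I, P (S i) & is_colimit f].

Section MonoidConditions.
Variable M : nmodType.

Definition alg_le (x y : M) : Prop := exists z : M, x + z = y.

Definition conical : Prop := forall x y : M, x + y = 0 -> x = 0 /\ y = 0.

Definition regular : Prop := forall x : M, alg_le (x *+ 2) x.

Definition refinement : Prop :=
  forall a0 a1 b0 b1 : M, a0 + a1 = b0 + b1 ->
  exists c00 c01 c10 c11 : M,
    [/\ a0 = c00 + c01, a1 = c10 + c11, b0 = c00 + c10 & b1 = c01 + c11].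

Definition idempotents : set M := [set x | x *+ 2 = x].

Definition group_at (e : M) : set M := [set x | alg_le e x /\ alg_le x e].

Definition transition (a b : M) (x : M) : M := x + b.

Definition emb : Prop :=
  forall a b : M, idempotents a -> idempotents b -> alg_le a b ->
    set_inj (group_at a) (transition a b).

(* Purity of H in the group G.  For n > 0 the n-th multiple in the group
   [group_at e] is the n-th multiple [x *+ n] in M; the value n = 0, where
   [x *+ 0] is the zero of M and not that of the group, is excluded and would
   impose no condition. *)
Definition pure (G H : set M) : Prop :=
  forall n : nat, (0 < n)%N ->
    H `&` [set x *+ n | x in G] `<=` [set x *+ n | x in H].

Definition pur : Prop :=
  forall a b : M, idempotents a -> idempotents b -> alg_le a b ->
    pure (group_at b) (transition a b @` group_at a).

End MonoidConditions.

(* Main.v *)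
Require Import Defs.
From HB Require Import structures.
From mathcomp Require Import boolp classical_sets.
From mathcomp Require Import all_boot all_order all_algebra.

Set Implicit Arguments.
Unset Strict Implicit.
Unset Printing Implicit Defensive.

Import Order.TTheory GRing.Theory.

Local Open Scope ring_scope.

(** A regular commutative monoid is a disjoint union of groups indexed by its
    idempotents.  The conditions on [M] are equivalent to axioms on a few elements
    at a time, [pure_refinement_monoid], in which idempotents and groups no
    longer occur.  These axioms hold in [adjoin_zero A] for every abelian group
    [A], and they pass to finite direct sums and to directed colimits, because an
    equation between elements of a directed colimit already holds at some stage
    ([colimit_elements]).  This is the direct implication.

    For the converse, [M] is the direct limit of all its finite approximations
    by sums of monoids [adjoin_zero C] with [C] cyclic, provided that every
    homomorphism [phi : N -> M] from such a sum with [phi x = phi y] factors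
    through another such sum in which [x] and [y] become equal
    ([direct_limit_criterion], [eval_kernel_factor]).  To factor [phi], use the
    embedding of [M] into the product of its semilattice of idempotents and its
    Grothendieck group [G] ([coordinates_inj]).  Let [a i] be the images of the
    generators of [N] and, for a set [T] of indices, let [A T] be the subgroup
    of [G] formed by the common minorants of the [a i], [i] in [T].  Refinement
    and purity imply that these subgroups generate a distributive lattice
    of pure subgroups, with [A T] and [A T'] meeting in [A (T :|: T')]
    ([minorant_group_distributive]).

    Such a family has adapted generators ([adapted_generators]).  Take the
    smallest [T] first: modulo the groups that come later, the components of the
    [a i] in [A T] generate a finitely generated group, the Smith normal form
    writes it as a sum of cyclic groups, and purity lifts the cyclic generators
    to elements of [A T] of the same orders; the errors of the lifts belong to
    later groups.  At the end, a relation between the [a i] in [G] holds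
    separately in each cyclic summand.  The idempotent part of [phi x = phi y]
    is dealt with by using only the sets [T] that meet both supports of [x] and
    [y] or neither of them: distributivity of the semilattice splits every [a i]
    into minorants of such sets ([balanced_cover]). *)

(** * Quotients of additive structures *)

Definition additive_of (M N : nmodType) (f : M -> N) (fM : nmod_morphism f) :
  {additive M -> N} := HB.pack f (GRing.isNmodMorphism.Build M N f fM).

(** The quotient of [T] by [r] consists of the classes [r x], as predicates.
    Asking for the laws of [op] up to [r] only allows [T] to be a type of
    representatives without any structure, as in the disjoint union of the
    stages of a directed system. *)
Lemma quotient_nmodule (T : Type) (r : T -> T -> Prop) (op : T -> T -> T)
    (z : T) :
    (forall x, r x x) -> (forall x y, r x y -> r y x) ->
    (forall x y w, r x y -> r y w -> r x w) ->
    (forall x x' y, r x x' -> r (op x y) (op x' y)) ->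
    (forall x y w, r (op x (op y w)) (op (op x y) w)) ->
    (forall x y, r (op x y) (op y x)) -> (forall x, r (op z x) x) ->
  exists (Q : nmodType) (pi : T -> Q),
    [/\ forall q, exists x, pi x = q, forall x y, pi x = pi y <-> r x y,
        {morph pi : x y / op x y >-> x + y} & pi z = 0].
Proof.
move=> rxx rsym rtrans rop opA opC op0.
pose Q := {A : T -> Prop | exists x, A = r x}.
pose pi x : Q := exist _ (r x) (ex_intro _ x erefl).
have piE x y : pi x = pi y <-> r x y.
  split=> [[/(congr1 (@^~ y)) ->]|rxy]; first exact: rxx.
  apply: eq_exist; apply/funext => w; apply/propext.
  by split=> [/(rtrans _ _ _ (rsym _ _ rxy))|/(rtrans _ _ _ rxy)].
have pisurj (q : Q) : {x | pi x = q}.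
  by apply: cid; case: q => A [x Ax]; exists x; apply: eq_exist.
pose rep q := projT1 (pisurj q).
have repK q : pi (rep q) = q := projT2 (pisurj q).
have rrep x : r (rep (pi x)) x by apply/piE; rewrite repK.
pose add p q := pi (op (rep p) (rep q)).
have rop2 x x' y y' : r x x' -> r y y' -> r (op x y) (op x' y').
  move=> rx ry; apply: (rtrans _ _ _ (rop _ _ _ rx)).
  apply: (rtrans _ _ _ (opC _ _)); apply: rtrans (opC _ _).
  exact: rop.
have addE x y : pi (op x y) = add (pi x) (pi y).
  by apply/piE/rop2; apply/rsym/rrep.
have addA : associative add.
  move=> p q s; rewrite -(repK p) -(repK q) -(repK s) -!addE.
  exact/piE/opA.
have addC : commutative add.
  by move=> p q; rewrite -(repK p) -(repK q) -!addE; apply/piE/opC.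
have add0 : left_id (pi z) add.
  by move=> p; rewrite -(repK p) -!addE; apply/piE/op0.
pose C : choiceType := HB.pack_for choiceType Q (gen_eqMixin Q) (gen_choiceMixin Q).
pose N : nmodType := HB.pack_for nmodType C
  (@GRing.isNmodule.Build C (pi z) add addA addC add0).
by exists N, pi; split=> // q; exists (rep q).
Qed.

Lemma grothendieck_group (M : nmodType) :
  exists (G : zmodType) (g : {additive M -> G}),
    forall x y, g x = g y <-> exists c, x + c = y + c.
Proof.
pose r (p q : M * M) := exists c, p.1 + q.2 + c = q.1 + p.2 + c.
pose op (p q : M * M) := (p.1 + q.1, p.2 + q.2).
have opA x y w : op x (op y w) = op (op x y) w by rewrite /op /= !addrA.
have opC x y : op x y = op y x by rewrite /op addrC [x.2 + _]addrC.
have op0 x : op (0, 0) x = x by case: x => x1 x2; rewrite /op /= !add0r.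
have rxx x : r x x by exists 0.
have [|||||||Q [pi [surj piE piD pi0]]] := @quotient_nmodule _ r op (0, 0).
- exact: rxx.
- by move=> x y [c e]; exists c.
- move=> [x1 x2] [y1 y2] [w1 w2] [c /= e] [d /= e']; exists (c + d + y1 + y2) => /=.
  have -> : x1 + w2 + (c + d + y1 + y2) = (x1 + y2 + c) + (y1 + w2 + d).
    by rewrite (AC (2*4) ((1*6*3)*(5*2*4))).
  by rewrite e e' (AC (3*3) ((4*2)*(3*6*1*5))).
- move=> [x1 x2] [y1 y2] [w1 w2] [c /= e]; exists c => /=.
  rewrite (AC (2*2*1) ((1*3*5)*(2*4))) /=.
  by rewrite e (AC (3*2) ((1*4)*(2*5)*3)).
- by move=> x y w; rewrite opA.
- by move=> x y; rewrite opC.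
- by move=> x; rewrite op0.
have pineg (q : Q) : {q' | q' + q = 0}.
  apply: cid; have [[x1 x2] <-] := surj q; exists (pi (x2, x1)).
  by rewrite -piD -pi0; apply/piE; exists 0; rewrite /= !addr0 add0r addrC.
pose opp q := projT1 (pineg q).
have oppK : left_inverse 0 opp +%R := fun q => projT2 (pineg q).
pose G : zmodType := HB.pack_for zmodType Q
  (GRing.Nmodule_isZmodule.Build Q oppK).
pose g0 (x : M) : G := pi (x, 0).
have g0_add : {morph g0 : x y / x + y} by move=> x y; rewrite /g0 -piD /op addr0.
have g0_0 : g0 0 = 0 by [].
exists G, (additive_of (conj g0_0 g0_add : nmod_morphism g0)) => x y.
by rewrite /= piE /r /= !addr0.
Qed.

(** * Elementary forms of the embedding and purity conditions *)

Lemma alg_le_refl (M : nmodType) (x : M) : alg_le x x.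
Proof. by exists 0; rewrite addr0. Qed.

Lemma alg_le_trans (M : nmodType) (x y z : M) :
  alg_le x y -> alg_le y z -> alg_le x z.
Proof. by move=> [u <-] [v <-]; exists (u + v); rewrite addrA. Qed.

Lemma alg_le_addr (M : nmodType) (x y : M) : alg_le x (x + y).
Proof. by exists y. Qed.

Lemma alg_le_addl (M : nmodType) (x y : M) : alg_le x (y + x).
Proof. by exists y; rewrite addrC. Qed.

Lemma alg_leD (M : nmodType) (x x' y y' : M) :
  alg_le x x' -> alg_le y y' -> alg_le (x + y) (x' + y').
Proof. by move=> [u <-] [v <-]; exists (u + v); rewrite addrACA. Qed.

Lemma alg_leMn (M : nmodType) (x y : M) n :
  alg_le x y -> alg_le (x *+ n) (y *+ n).
Proof. by move=> [u <-]; exists (u *+ n); rewrite mulrnDl. Qed.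

Lemma alg_le_mulrn (M : nmodType) (x : M) n : (0 < n)%N -> alg_le x (x *+ n).
Proof. by case: n => // n _; rewrite mulrS; apply: alg_le_addr. Qed.

Lemma idempotent_mulrn (M : nmodType) (e : M) n :
  e + e = e -> (0 < n)%N -> e *+ n = e.
Proof.
by move=> ee; case: n => // n _; elim: n => [|n IHn] //; rewrite mulrS IHn.
Qed.

Lemma regular_mulrn_le (M : nmodType) (x : M) n :
  regular M -> (0 < n)%N -> alg_le (x *+ n) x.
Proof.
move=> regM; case: n => // n _; elim: n => [|n IHn]; first exact: alg_le_refl.
rewrite mulrS; apply: alg_le_trans (regM x).
by rewrite mulr2n; apply: alg_leD IHn; apply: alg_le_refl.
Qed.

(** In a regular monoid every [x] lies in a group, in which [y] is the inverse of
    [x] and [x + y] is the neutral element. *)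
Lemma regular_inverse (M : nmodType) (x : M) :
  regular M -> exists y : M, x + y + x = x /\ y + x + y = y.
Proof.
move=> /(_ x)[z]; rewrite mulr2n => e; exists (z + x + z).
have e' : x + z + x = x by rewrite addrAC.
have -> : x + (z + x + z) + x = x + z + x + z + x by rewrite !addrA.
split; first by rewrite !e'.
have -> : z + x + z + x + (z + x + z) = z + (x + z + x + z + x) + z.
  by rewrite !addrA.
by rewrite !e'.
Qed.

(** Two elements are below each other exactly when they lie in the same maximal
    subgroup.  The pair [u], [v] witnesses this for [x] and [x + u], so the
    condition says that distinct elements of a group stay distinct after adding
    any [c]: this is [emb] with the idempotents eliminated. *)
Definition cancellative_below (M : nmodType) : Prop :=
  forall x u v c : M, x + u + v = x -> x + u + c = x + c -> x + u = x.

(** Here [x + x'] is the neutral element of the group of [x]; the second premise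
    says that [y], moved to that group, is the multiple [x *+ n].  The root [w]
    is found in the group of [y] itself, as [pur] and [emb] require. *)
Definition root_closed_below (M : nmodType) : Prop :=
  forall (n : nat) (x x' y : M), (0 < n)%N ->
    x + x' + x = x -> y + (x + x') = x *+ n -> exists w, y = w *+ n.

Lemma emb_cancellative (M : nmodType) :
  regular M -> emb M <-> cancellative_below M.
Proof.
move=> regM; split=> [embM x u v c xuv xuc | cancM a b _ _ _ x y].
  have [z [xzx zxz]] := regular_inverse x regM.
  have [d [cdc dcd]] := regular_inverse c regM.
  have idem p q : p + q + p = p -> p + q + (p + q) = p + q :> M.
    by move=> e; rewrite addrA e.
  have /= := embM (x + z) (x + z + (c + d)).
  rewrite /idempotents /transition /= mulr2n => /(_ (idem _ _ xzx)).
  have -> : (x + z + (c + d)) *+ 2 = x + z + (c + d).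
    by rewrite mulr2n addrACA !idem.
  move=> /(_ erefl (alg_le_addr _ _)) H; apply: H.
  - apply: mem_set; split; first by exists (x + u); rewrite addrA xzx.
    by exists (v + z); rewrite addrA xuv.
  - apply: mem_set; split; first by exists x; rewrite xzx.
    exact: alg_le_addr.
  - have -> : x + u + (x + z + (c + d)) = x + u + c + (x + z + d).
      by rewrite (AC (2*(2*2)) (((1*2)*5)*((3*4)*6))).
    by rewrite xuc (AC (2*3) (1*(3*4*(2*5)))).
rewrite !in_setE => -[ax xa] [ay ya]; rewrite /transition => exy.
have [u xu] := alg_le_trans xa ay; have [v yv] := alg_le_trans ya ax.
by rewrite -xu (@cancM x u v b) // ?xu.
Qed.

Lemma pur_root_closed (M : nmodType) :
  regular M -> emb M -> pur M <-> root_closed_below M.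
Proof.
move=> regM embM; split=> [purM n x x' y n0 xx yx | rootM a b].
  pose b := x + x'; have bb : b + b = b by rewrite /b addrA xx.
  have [z [yzy zyz]] := regular_inverse y regM; pose a := y + z.
  have aa : a + a = a by rewrite /a addrA yzy.
  have ia : idempotents a by rewrite /idempotents /= mulr2n.
  have ib : idempotents b by rewrite /idempotents /= mulr2n.
  have yb : alg_le y b.
    rewrite -(idempotent_mulrn bb n0) /b mulrnDl -yx.
    by exists (x + x' + x' *+ n); rewrite !addrA.
  have ya : alg_le y a by apply: alg_le_addr.
  have ay : alg_le a y by exists y; rewrite yzy.
  have ab := alg_le_trans ay yb.
  have [|w [p [ap pa] <-]] := purM a b ia ib ab n n0 (y + b).
    split; first by exists y.
    exists x; last by rewrite /b yx.
    by split; [exists x; rewrite xx | exists x'].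
  rewrite /transition mulrnDl (idempotent_mulrn bb n0) => pb; exists p.
  apply: (embM a b ia ib ab); rewrite ?in_setE // -?pb //.
  split; first exact: alg_le_trans ap (alg_le_mulrn _ n0).
  by rewrite -(idempotent_mulrn aa n0); apply: alg_leMn.
rewrite /idempotents /= !mulr2n => aa bb ab n n0 h [[y [ay ya] <-]] [x [bx xb]].
have [w xw] := xb; have [t bt] := bx.
have bxx : b + x = x by rewrite -bt addrA bb.
rewrite /transition => xy.
have [||v yv] := rootM n x w y n0; rewrite ?xw //.
exists (v + b); last by rewrite mulrnDl (idempotent_mulrn bb n0) yv.
exists v => //; split; last first.
  by apply: alg_le_trans ya; rewrite yv; apply: alg_le_mulrn.
by apply: (alg_le_trans ay); rewrite yv; apply: regular_mulrn_le.
Qed.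

(** All the conditions are now implications between equations, with an
    existential conclusion: the form that directed colimits preserve. *)
Definition pure_refinement_monoid (M : nmodType) : Prop :=
  [/\ regular M, conical M, refinement M, cancellative_below M &
      root_closed_below M].

Lemma pure_refinement_monoidP (M : nmodType) :
  [/\ regular M, conical M, refinement M, emb M & pur M] <->
  pure_refinement_monoid M.
Proof.
split=> -[r c f e p]; split=> //.
- exact/emb_cancellative.
- exact/pur_root_closed.
- exact/emb_cancellative.
- by apply/pur_root_closed => //; apply/emb_cancellative.
Qed.

(** * Finite sums of groups with a zero adjoined *)

Lemma pure_refinement_iso (M N : nmodType) :
  nmod_isomorphic M N -> pure_refinement_monoid N -> pure_refinement_monoid M.
Proof.
move=> [f [g fK gK]] [regN conN refN canN rootN].
have finj := can_inj fK.
split.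
- move=> x; have [z e] := regN (f x); exists (g z).
  by apply: finj; rewrite raddfD raddfMn gK.
- move=> x y /(congr1 f); rewrite raddfD raddf0 => /conN[x0 y0].
  by split; apply: finj; rewrite raddf0.
- move=> a0 a1 b0 b1 /(congr1 f); rewrite !raddfD => /refN.
  move=> [c00 [c01 [c10 [c11 [e1 e2 e3 e4]]]]].
  by exists (g c00), (g c01), (g c10), (g c11);
    split; apply: finj; rewrite raddfD !gK.
- move=> x u v c /(congr1 f); rewrite !raddfD => xuv.
  move=> /(congr1 f); rewrite !raddfD => xuc.
  by apply: finj; rewrite raddfD; apply: canN xuv xuc.
- move=> n x x' y n0 /(congr1 f); rewrite !raddfD => xx.
  move=> /(congr1 f); rewrite raddfMn !raddfD => yx.
  have [w yw] := rootN n _ _ _ n0 xx yx.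
  by exists (g w); apply: finj; rewrite raddfMn gK.
Qed.

Lemma adjoin_zero_Some_mulrn (A : zmodType) (a : A) n : (0 < n)%N ->
  (Some a : adjoin_zero A) *+ n = Some (a *+ n).
Proof.
by case: n => // n _; elim: n => [|n IHn] //; rewrite mulrS IHn [a *+ n.+2]mulrS.
Qed.

Lemma pure_refinement_adjoin_zero (A : zmodType) :
  pure_refinement_monoid (adjoin_zero A).
Proof.
pose S (a : A) : adjoin_zero A := Some a; pose N : adjoin_zero A := None.
split.
- by move=> [a|]; [exists (S (- a)); congr Some; rewrite addrK | exists N].
- by move=> [a|] [b|].
- move=> [a|] [a'|] [b|] [b'|] //= e.
  + exists (S a), (S 0), (S (b - a)), (S b').
    case: e => e; split; congr Some; rewrite ?addr0 ?add0r //;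
      last by rewrite addrC subrK.
    by rewrite addrAC -e addrC addKr.
  + by exists (S a), N, (S a'), N; split=> //; exact: esym.
  + by exists N, (S a), N, (S a'); split=> //; exact: esym.
  + by exists (S b), (S b'), N, N; split=> //; exact: esym.
  + by exists (S a), N, N, N; split=> //; exact: esym.
  + by exists N, (S a), N, N; split=> //; exact: esym.
  + by exists N, N, (S b), (S b'); split=> //; exact: esym.
  + by exists N, N, (S a'), N; split=> //; exact: esym.
  + by exists N, N, N, (S a'); split=> //; exact: esym.
  + by exists N, N, N, N.
- move=> [a|] [u|] [v|] [c|] // _ xuc; rewrite /GRing.add /=;
    by [exact: xuc | case: xuc => /addIr ->].
- move=> n x x' [y|] n0; last by exists N; rewrite (mul0rn (adjoin_zero A)).
  case: x => [a|]; last by case: x' => [a'|] //; rewrite (mul0rn (adjoin_zero A)).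
  rewrite adjoin_zero_Some_mulrn // => xx yx; exists (S a).
  rewrite adjoin_zero_Some_mulrn //; case: x' xx yx => [a'|] /= [aa] [<-].
    have /addIr -> : a + a' + a = 0 + a by rewrite add0r.
    by rewrite addr0.
  by have /addIr -> : a + a = 0 + a; rewrite ?add0r ?addr0.
Qed.

Lemma direct_sumD (k : nat) (T : 'I_k -> nmodType) (x y : direct_sum T) i :
  (x + y) i = x i + y i.
Proof. exact: ffunE. Qed.

Lemma direct_sum0 (k : nat) (T : 'I_k -> nmodType) i :
  (0 : direct_sum T) i = 0.
Proof. exact: ffunE. Qed.

Lemma direct_sum_mulrn (k : nat) (T : 'I_k -> nmodType) (x : direct_sum T) n i :
  (x *+ n) i = x i *+ n.
Proof.
elim: n => [|n IHn]; first by rewrite !mulr0n direct_sum0.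
by rewrite !mulrS direct_sumD IHn.
Qed.

Lemma pure_refinement_direct_sum (k : nat) (T : 'I_k -> nmodType) :
  (forall i, pure_refinement_monoid (T i)) ->
  pure_refinement_monoid (direct_sum T).
Proof.
move=> niceT.
have at_ i (x y : direct_sum T) : x = y -> x i = y i by move=> ->.
split.
- move=> x; have H i : exists z, x i *+ 2 + z = x i.
    by have [reg _ _ _ _] := niceT i; apply: reg.
  exists [ffun i => projT1 (cid (H i))]; apply/ffunP => i.
  by rewrite direct_sumD direct_sum_mulrn ffunE; case: (cid (H i)).
- move=> x y xy; have H i : x i = 0 /\ y i = 0.
    have [_ conT _ _ _] := niceT i.
    by apply: conT; move/(at_ i): xy; rewrite !(direct_sumD, ffunE).
  by split; apply/ffunP => i; rewrite direct_sum0; case: (H i).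
- move=> a0 a1 b0 b1 ab.
  pose P i (c : T i * T i * T i * T i) :=
    [/\ a0 i = c.1.1.1 + c.1.1.2, a1 i = c.1.2 + c.2,
        b0 i = c.1.1.1 + c.1.2 & b1 i = c.1.1.2 + c.2].
  have H i : exists c, P i c.
    have [_ _ refT _ _] := niceT i; move/(at_ i): ab; rewrite !direct_sumD.
    by move/refT => [c [d [e [f ?]]]]; exists (c, d, e, f).
  pose c i := projT1 (cid (H i)); have cP i : P i (c i) := projT2 (cid (H i)).
  exists [ffun i => (c i).1.1.1], [ffun i => (c i).1.1.2],
    [ffun i => (c i).1.2], [ffun i => (c i).2].
  by split; apply/ffunP => i; rewrite !(direct_sumD, ffunE); case: (cP i).
- move=> x u v c xuv xuc; apply/ffunP => i; have [_ _ _ canT _] := niceT i.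
  rewrite direct_sumD; apply: (canT _ _ (v i) (c i)).
    by move/(at_ i): xuv; rewrite !(direct_sumD, ffunE).
  by move/(at_ i): xuc; rewrite !(direct_sumD, ffunE).
- move=> n x x' y n0 xx yx; have H i : exists w, y i = w *+ n.
    have [_ _ _ _ rootT] := niceT i; apply: (rootT n (x i) (x' i)) => //.
      by move/(at_ i): xx; rewrite !(direct_sumD, ffunE).
    by move/(at_ i): yx; rewrite direct_sum_mulrn !(direct_sumD, direct_sum0, ffunE).
  exists [ffun i => projT1 (cid (H i))]; apply/ffunP => i.
  by rewrite direct_sum_mulrn ffunE; case: (cid (H i)).
Qed.

Lemma pure_refinement_finite_sum_of_basic (N : nmodType) :
  finite_sum_of_basic N -> pure_refinement_monoid N.
Proof.
move=> [k [T [basicT isoN]]]; apply: pure_refinement_iso isoN _.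
apply: pure_refinement_direct_sum => i.
have [[n]|] := basicT i; move=> /pure_refinement_iso; apply.
  exact: pure_refinement_adjoin_zero.
exact: pure_refinement_adjoin_zero.
Qed.

(** * Elements of a directed colimit *)

Section DirectedColimit.
Variables (disp : Order.disp_t) (I : preorderType disp) (S : direct_system I).
Variables (M : nmodType) (f : forall i : I, {additive S i -> M}).
Hypotheses (dirI : directed I) (colimf : is_colimit f).

Local Notation "i ~> x" := (existT (fun k : I => S k : Type) i x)
  (at level 60).

(** A germ is an element of some stage; two germs are equal in the colimit when
    they have the same image at a later stage. *)
Definition eventually_eq (p q : {i : I & S i}) : Prop :=
  exists (k : I) (hp : (tag p <= k)%O) (hq : (tag q <= k)%O),
    ds_map S hp (tagged p) = ds_map S hq (tagged q).

Lemma eventually_eq_map (i j : I) (hij : (i <= j)%O) (x : S i) :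
  eventually_eq (i ~> x) (j ~> ds_map S hij x).
Proof.
by exists j, hij, (lexx j) => /=; rewrite ds_map_id.
Qed.

Lemma eventually_eq_refl p : eventually_eq p p.
Proof. by exists (tag p), (lexx _), (lexx _). Qed.

Lemma eventually_eq_sym p q : eventually_eq p q -> eventually_eq q p.
Proof. by move=> [k [hp [hq e]]]; exists k, hq, hp. Qed.

Lemma eventually_eq_trans p q r :
  eventually_eq p q -> eventually_eq q r -> eventually_eq p r.
Proof.
move=> [k [hp [hq e]]] [l [hq' [hr e']]]; have [m [km lm]] := dirI.2 k l.
exists m, (le_trans hp km), (le_trans hr lm).
rewrite -(ds_map_comp hp km) -(ds_map_comp hr lm) e -e'.
by rewrite !(ds_map_comp _ _ (le_trans hq km)).
Qed.

(** The concrete colimit, a cocone that identifies nothing more than needed. *)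
Lemma colimit_germs :
  exists (Q : nmodType) (g : forall i : I, {additive S i -> Q}),
    [/\ is_cocone g,
        forall (i j : I) (x : S i) (y : S j),
          g i x = g j y -> eventually_eq (i ~> x) (j ~> y) &
        forall q, exists i (x : S i), g i x = q].
Proof.
have [[i0 _] ub] := dirI.
pose T := {i : I & S i}.
have /choice[bnd bndP] : forall p : T * T,
    exists k, (tag p.1 <= k)%O /\ (tag p.2 <= k)%O by move=> p; apply: ub.
pose op (p q : T) : T := bnd (p, q) ~>
  ds_map S (bndP (p, q)).1 (tagged p) + ds_map S (bndP (p, q)).2 (tagged q).
have opE (p q : T) k (hp : (tag p <= k)%O) (hq : (tag q <= k)%O) :
  eventually_eq (op p q) (k ~> ds_map S hp (tagged p) + ds_map S hq (tagged q)).
  have [m [km bm]] := ub k (bnd (p, q)).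
  apply: eventually_eq_trans (eventually_eq_map bm _) _; apply: eventually_eq_sym.
  apply: eventually_eq_trans (eventually_eq_map km _) _.
  rewrite /= !raddfD /=.
  rewrite !(ds_map_comp _ _ (le_trans hp km)) !(ds_map_comp _ _ (le_trans hq km)).
  exact: eventually_eq_refl.
have opl p p' q : eventually_eq p p' -> eventually_eq (op p q) (op p' q).
  move=> [k [hp [hp' e]]]; have [m [km qm]] := ub k (tag q).
  apply: eventually_eq_trans (opE p q m (le_trans hp km) qm) _.
  apply: eventually_eq_sym.
  apply: eventually_eq_trans (opE p' q m (le_trans hp' km) qm) _.
  rewrite -(ds_map_comp hp km) -(ds_map_comp hp' km) e.
  exact: eventually_eq_refl.
have opA p q r : eventually_eq (op p (op q r)) (op (op p q) r).
  have [k1 [a1 a2]] := ub (bnd (q, r)) (bnd (p, q)).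
  have [k2 [b1 b2]] := ub (tag p) (tag r).
  have [m [k1m k2m]] := ub k1 k2.
  have qrm := le_trans a1 k1m; have pqm := le_trans a2 k1m.
  have pm := le_trans b1 k2m; have rm := le_trans b2 k2m.
  have qm : (tag q <= m)%O := le_trans (bndP (q, r)).1 qrm.
  apply: eventually_eq_trans (opE p (op q r) m pm qrm) _; apply: eventually_eq_sym.
  apply: eventually_eq_trans (opE (op p q) r m pqm rm) _.
  rewrite /= !raddfD /= !(ds_map_comp _ _ pm, ds_map_comp _ _ qm, ds_map_comp _ _ rm).
  by rewrite addrA; apply: eventually_eq_refl.
have opC p q : eventually_eq (op p q) (op q p).
  have [m [pm qm]] := ub (tag p) (tag q).
  apply: eventually_eq_trans (opE p q m pm qm) _; apply: eventually_eq_sym.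
  apply: eventually_eq_trans (opE q p m qm pm) _; rewrite addrC.
  exact: eventually_eq_refl.
have op0 p : eventually_eq (op (i0 ~> 0) p) p.
  have [m [im pm]] := ub i0 (tag p).
  apply: eventually_eq_trans (opE (i0 ~> 0) p m im pm) _; apply: eventually_eq_sym.
  rewrite /= raddf0 add0r; case: p pm => i x pm; exact: eventually_eq_map.
have [Q [pi [surj piE piD pi0]]] := quotient_nmodule eventually_eq_refl
  eventually_eq_sym eventually_eq_trans opl opA opC op0.
have gM i : nmod_morphism (fun x : S i => pi (i ~> x)).
  split=> [|x y].
    have [m [im jm]] := ub i i0; rewrite -pi0; apply/piE; exists m, im, jm.
    by rewrite /= !raddf0.
  rewrite -piD; apply/piE/eventually_eq_sym.
  apply: eventually_eq_trans (opE (i ~> x) (i ~> y) i (lexx i) (lexx i)) _.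
  by rewrite /= !ds_map_id; apply: eventually_eq_refl.
exists Q, (fun i => additive_of (gM i)); split.
- by move=> i j hij x /=; apply/piE/eventually_eq_sym/eventually_eq_map.
- by move=> i j x y /piE.
- by move=> q; have [[i x] <-] := surj q; exists i, x.
Qed.

(** Comparing [M] with the concrete colimit by means of the universal property
    shows that the two maps between them are inverse to each other; only the
    facts about elements are kept. *)
Lemma colimit_elements :
  (forall m, exists i (x : S i), f i x = m) /\
  (forall (i j : I) (x : S i) (y : S j),
      f i x = f j y -> eventually_eq (i ~> x) (j ~> y)).
Proof.
have [cof univ] := colimf.
have [Q [g [cog geq gsurj]]] := colimit_germs.
have [h [hf _]] := univ Q g cog.
split=> [m|i j x y e]; last by apply: geq; rewrite -!hf e.
have /choice[s sP] : forall q : Q, exists p : {i : I & S i}, g (tag p) (tagged p) = q.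
  by move=> q; have [i [x <-]] := gsurj q; exists (i ~> x).
pose u q := f (tag (s q)) (tagged (s q)).
have fE (p q : {i : I & S i}) : eventually_eq p q ->
    f (tag p) (tagged p) = f (tag q) (tagged q).
  by move=> [k [hp [hq e]]]; rewrite -(cof _ _ hp) -(cof _ _ hq) e.
have uE i (x : S i) : u (g i x) = f i x.
  by apply: (fE _ (i ~> x)); case: (s _) (sP (g i x)) => j y; apply: geq.
have uM : nmod_morphism u.
  have [i0 _] := dirI.1; split=> [|p q].
    by rewrite -(raddf0 (g i0)) uE raddf0.
  have [i [x <-]] := gsurj p; have [j [y <-]] := gsurj q.
  have [k [ik jk]] := dirI.2 i j.
  by rewrite -(cog _ _ ik) -(cog _ _ jk) -raddfD !uE raddfD.
have [h0 [_ h0uniq]] := univ M f cof.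
pose uh : {additive M -> M} := additive_of uM \o h.
have idE : idfun =1 h0.
  by apply: (h0uniq (idfun : {additive M -> M})).
have uhE : uh =1 h0 by apply: h0uniq => i x; rewrite /= hf uE.
have um : u (h m) = m by rewrite -[LHS]/(uh m) uhE -idE.
by exists (tag (s (h m))), (tagged (s (h m))).
Qed.

Lemma colimit_lift (s : seq M) :
  exists (i : I) (t : seq (S i)), s = map (f i) t.
Proof.
have [surj _] := colimit_elements; have [cof _] := colimf.
elim: s => [|m s [i [t ->]]]; first by have [i _] := dirI.1; exists i, [::].
have [j [x <-]] := surj m; have [k [ik jk]] := dirI.2 i j.
exists k, (ds_map S jk x :: map (ds_map S ik) t) => /=.
by rewrite cof -map_comp; congr cons; apply: eq_map => y /=; rewrite cof.
Qed.

Lemma colimit_eq (i : I) (x y : S i) :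
  f i x = f i y -> exists (j : I) (hij : (i <= j)%O), ds_map S hij x = ds_map S hij y.
Proof.
have [_ inj] := colimit_elements.
move=> /inj[k [h1 [h2 /= e]]]; exists k, h1.
by rewrite e (Prop_irrelevance h1 h2).
Qed.

Lemma pure_refinement_colimit :
  (forall i, pure_refinement_monoid (S i)) -> pure_refinement_monoid M.
Proof.
move=> niceS; have [cof _] := colimf; split.
- move=> m; have [i [[|x [|//]] //= [->]]] := colimit_lift [:: m].
  have [regS _ _ _ _] := niceS i; have [z e] := regS x.
  by exists (f i z); rewrite -[RHS](congr1 (f i) e) raddfD raddfMn.
- move=> m n; have [i [[|x [|y [|//]]] //= [-> ->]]] := colimit_lift [:: m; n].
  rewrite -raddfD -(raddf0 (f i)) => /colimit_eq[j [ij]].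
  have [_ conS _ _ _] := niceS j; rewrite raddfD raddf0 => /conS[x0 y0].
  by rewrite -!(cof _ _ ij) x0 y0 !raddf0.
- move=> a0 a1 b0 b1.
  have [i [[|x0 [|x1 [|y0 [|y1 [|//]]]]] //= [-> -> -> ->]]] :=
    colimit_lift [:: a0; a1; b0; b1].
  rewrite -!raddfD => /colimit_eq[j [ij]]; have [_ _ refS _ _] := niceS j.
  rewrite !raddfD => /refS[c00 [c01 [c10 [c11 [e1 e2 e3 e4]]]]].
  exists (f j c00), (f j c01), (f j c10), (f j c11).
  by rewrite -!(cof _ _ ij) e1 e2 e3 e4 !raddfD.
- move=> m u v c.
  have [i [[|x [|xu [|xv [|xc [|//]]]]] //= [-> -> -> ->]]] :=
    colimit_lift [:: m; u; v; c].
  rewrite -!raddfD => /colimit_eq[j [ij e]] /colimit_eq[k [ik e']].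
  have [l [jl kl]] := dirI.2 j k; have il := le_trans ij jl.
  have [_ _ _ canS _] := niceS l.
  rewrite -!(cof _ _ il); congr (f l _); rewrite raddfD.
  apply: (canS _ _ (ds_map S il xv) (ds_map S il xc)); rewrite -!raddfD.
    by rewrite -!(ds_map_comp ij jl il) e.
  by rewrite -!(ds_map_comp ik kl il) e'.
- move=> n m m' p n0.
  have [i [[|x [|x' [|y [|//]]]] //= [-> -> ->]]] := colimit_lift [:: m; m'; p].
  rewrite -raddfMn -!raddfD => /colimit_eq[j [ij e]] /colimit_eq[k [ik e']].
  have [l [jl kl]] := dirI.2 j k; have il := le_trans ij jl.
  have [_ _ _ _ rootS] := niceS l.
  have [||w yw] := rootS n (ds_map S il x) (ds_map S il x') (ds_map S il y) n0.
  + by rewrite -!raddfD -!(ds_map_comp ij jl il) e.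
  + by rewrite -raddfMn -!raddfD -!(ds_map_comp ik kl il) e'.
  by exists (f l w); rewrite -(cof _ _ il) yw raddfMn.
Qed.

End DirectedColimit.

(** * A criterion for being a direct limit *)

(** A monoid [M] is the direct limit of the objects mapping to it when these maps
    are jointly surjective and form a filtered category.  To get a preordered set
    instead of a category, objects are rigidified by labels: an index is an
    object in which finitely many elements, the generators among them, carry
    labels in [M * nat], and a comparison map has to preserve labels.  It is
    then unique, so that functoriality is automatic.  The first component of a
    label is the value in [M] of the labelled element; the second one provides
    enough labels for distinct generators with the same value. *)
Section DirectLimitCriterion.
Variables (M : nmodType) (P : nmodType -> Prop) (Obj : Type).
Variables (N : Obj -> nmodType) (phi : forall o, {additive N o -> M}).
Variable gens : forall o, seq (N o).
Hypothesis gens_epi : forall o (M' : nmodType) (h h' : {additive N o -> M'}),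
  {in gens o, h =1 h'} -> h =1 h'.
Hypothesis phi_surj : forall m, exists o (x : N o), phi o x = m.
Hypothesis joint_factor : forall o1 o2, exists o
  (h1 : {additive N o1 -> N o}) (h2 : {additive N o2 -> N o}),
  (forall x, phi o (h1 x) = phi o1 x) /\ (forall x, phi o (h2 x) = phi o2 x).
Hypothesis kernel_factor : forall o (x y : N o), phi o x = phi o y ->
  exists o' (h : {additive N o -> N o'}),
    (forall w, phi o' (h w) = phi o w) /\ h x = h y.

Local Notation label := (M * nat)%type.

Record labelled := Labelled {
  lobj : Obj;
  dom : seq label;
  lab : label -> N lobj;
  labP : forall s, s \in dom -> phi lobj (lab s) = s.1;
  lab_gens : forall u, u \in gens lobj -> exists2 s, s \in dom & lab s = u
}.

HB.instance Definition _ := gen_eqMixin labelled.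
HB.instance Definition _ := gen_choiceMixin labelled.

Definition extends (i j : labelled) : Prop :=
  {subset dom i <= dom j} /\
  exists h : {additive N (lobj i) -> N (lobj j)},
    forall s, s \in dom i -> h (lab i s) = lab j s.

Fact labelled_display : Order.disp_t. Proof. exact: Order.Disp tt tt. Qed.

Definition extendsb (i j : labelled) : bool := `[< extends i j >].

Fact extendsb_refl : reflexive extendsb.
Proof. by move=> i; apply/asboolP; split=> //; exists idfun. Qed.

Fact extendsb_trans : transitive extendsb.
Proof.
move=> j i k /asboolP[sij [h hP]] /asboolP[sjk [h' hP']]; apply/asboolP.
split=> [s /sij/sjk //|]; exists (h' \o h) => s si /=.
by rewrite hP // hP' //; apply: sij.
Qed.

HB.instance Definition _ := Order.Le_isPreorder.Build labelled_display labelled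
  extendsb_refl extendsb_trans.

Lemma extends_of_le (i j : labelled) : (i <= j)%O -> extends i j.
Proof. by move/asboolP. Qed.

Definition transition_map (i j : labelled) (hij : (i <= j)%O) :
  {additive N (lobj i) -> N (lobj j)} := projT1 (cid (extends_of_le hij).2).

Lemma transition_mapP (i j : labelled) (hij : (i <= j)%O) s :
  s \in dom i -> transition_map hij (lab i s) = lab j s.
Proof. by rewrite /transition_map; case: cid => h /= hP; apply: hP. Qed.

Lemma transition_map_uniq (i j : labelled) (hij : (i <= j)%O)
    (h : {additive N (lobj i) -> N (lobj j)}) :
  (forall s, s \in dom i -> h (lab i s) = lab j s) -> transition_map hij =1 h.
Proof.
move=> hP; apply: gens_epi => _ /lab_gens[s si <-].
by rewrite transition_mapP // hP.
Qed.

Fact transition_map_id (i : labelled) (hii : (i <= i)%O) x :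
  transition_map hii x = x.
Proof. exact: (@transition_map_uniq i i hii idfun). Qed.

Fact transition_map_comp (i j k : labelled) (hij : (i <= j)%O) (hjk : (j <= k)%O)
    (hik : (i <= k)%O) x :
  transition_map hjk (transition_map hij x) = transition_map hik x.
Proof.
rewrite (@transition_map_uniq i k hik (transition_map hjk \o transition_map hij)) //.
move=> s si /=; rewrite !transition_mapP //.
by have [sij _] := extends_of_le hij; apply: sij.
Qed.

Definition labelled_system : direct_system labelled :=
  Build_direct_system transition_map_id transition_map_comp.

Lemma phi_transition_map (i j : labelled) (hij : (i <= j)%O) x :
  phi (lobj j) (transition_map hij x) = phi (lobj i) x.
Proof.
have /(_ _) := @gens_epi _ _ (phi (lobj j) \o transition_map hij) (phi (lobj i)).
apply=> _ /lab_gens[s si <-] /=; have [sij _] := extends_of_le hij.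
by rewrite transition_mapP // !labP //; apply: sij.
Qed.

(** Any finite partial labelling of an object extends to a complete one: the
    generators get labels whose second component has not been used yet. *)
Lemma label_object (o : Obj) (d : seq label) (p : label -> N o) :
    (forall s, s \in d -> phi o (p s) = s.1) ->
  exists (d' : seq label) (p' : label -> N o)
    (p'P : forall s, s \in d' -> phi o (p' s) = s.1)
    (p'G : forall u, u \in gens o -> exists2 s, s \in d' & p' s = u),
    {subset d <= d'} /\ {in d, p =1 p'}.
Proof.
move=> pP; pose K := (\max_(s <- d) s.2).+1.
have dK s : s \in d -> (s.2 < K)%N by move=> sd; rewrite ltnS; apply: leq_bigmax_seq.
pose g t := nth 0 (gens o) t.
pose d' := d ++ [seq (phi o (g t), K + t)%N | t <- iota 0 (size (gens o))].
pose p' s := if s \in d then p s else g (s.2 - K)%N.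
have fresh m t : (m, K + t)%N \in d = false.
  by apply/negP => /dK /=; rewrite ltnNge leq_addr.
have p'P s : s \in d' -> phi o (p' s) = s.1.
  rewrite mem_cat /p'; case: ifP => [sd _|_ /=]; first exact: pP.
  by case/mapP => t _ ->; rewrite addKn.
have p'G u : u \in gens o -> exists2 s, s \in d' & p' s = u.
  move=> ug; exists (phi o u, K + index u (gens o))%N.
    rewrite mem_cat; apply/orP; right; apply/mapP; exists (index u (gens o)).
      by rewrite mem_iota index_mem.
    by rewrite /g nth_index.
  by rewrite /p' fresh addKn /g nth_index.
exists d', p', p'P, p'G; split=> s sd; first by rewrite mem_cat sd.
by rewrite /p' sd.
Qed.

Lemma extend_along (i : labelled) (o : Obj) (h : {additive N (lobj i) -> N o}) :
    (forall x, phi o (h x) = phi (lobj i) x) ->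
  exists (j : labelled) (hij : (i <= j)%O),
    forall x y, h x = h y -> transition_map hij x = transition_map hij y.
Proof.
move=> hphi; have [|d [p [pP [pG [sub ext]]]]] :=
  @label_object o (dom i) (h \o lab i).
  by move=> s si /=; rewrite hphi labP.
pose j := Labelled pP pG.
have hij : (i <= j)%O by apply/asboolP; split=> //; exists h => s si; apply: ext.
have hE : transition_map hij =1 h.
  by apply: (@transition_map_uniq i j hij h) => s si; apply: ext.
by exists j, hij => x y hxy; rewrite !hE.
Qed.

Lemma factor_pairs (o : Obj) (r : seq (N o * N o)) :
    (forall q, q \in r -> phi o q.1 = phi o q.2) ->
  exists o' (h : {additive N o -> N o'}),
    (forall w, phi o' (h w) = phi o w) /\ forall q, q \in r -> h q.1 = h q.2.
Proof.
elim: r => [|q r IHr] rP; first by exists o, idfun.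
have [|o1 [h1 [h1P h1r]]] := IHr.
  by move=> s sr; apply: rP; rewrite inE sr orbT.
have [|o2 [h2 [h2P h2q]]] := @kernel_factor o1 (h1 q.1) (h1 q.2).
  by rewrite !h1P rP ?mem_head.
exists o2, (h2 \o h1); split=> [w|s] /=; first by rewrite h2P h1P.
by rewrite inE => /predU1P[-> //|/h1r ->].
Qed.

(** Labels shared by two indices must be given to one element: the two labelled
    elements have the same value in [M], so [factor_pairs] identifies them. *)
Lemma directed_labelled : directed labelled.
Proof.
split.
  have [o [x _]] := phi_surj 0.
  have [//|d [p [pP [pG _]]]] := @label_object o [::] (fun=> 0).
  by exists (Labelled pP pG).
move=> i j; have [o [h1 [h2 [h1P h2P]]]] := joint_factor (lobj i) (lobj j).
have [|o' [h [hP hr]]] := @factor_pairs o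
  [seq (h1 (lab i s), h2 (lab j s)) | s <- dom i & s \in dom j].
  move=> q /mapP[s]; rewrite mem_filter => /andP[sj si] -> /=.
  by rewrite h1P h2P !labP.
pose p s := if s \in dom i then h (h1 (lab i s)) else h (h2 (lab j s)).
have pj s : s \in dom j -> p s = h (h2 (lab j s)).
  rewrite /p; case: ifP => // si sj.
  apply: (hr (h1 (lab i s), h2 (lab j s))).
  by apply/mapP; exists s; rewrite // mem_filter sj si.
have [|d [q [qP [qG [sub ext]]]]] := @label_object o' (dom i ++ dom j) p.
  move=> s; rewrite mem_cat => /orP[si|sj].
    by rewrite /p si hP h1P labP.
  by rewrite pj // hP h2P labP.
exists (Labelled qP qG); split; apply/asboolP; split.
- by move=> s si; apply: sub; rewrite mem_cat si.
- exists (h \o h1) => s si; rewrite /= -ext ?mem_cat ?si //.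
  by rewrite /p si.
- by move=> s sj; apply: sub; rewrite mem_cat sj orbT.
- by exists (h \o h2) => s sj; rewrite /= -ext ?mem_cat ?sj ?orbT // pj.
Qed.

Lemma labelled_colimit :
  is_colimit (S := labelled_system) (fun i => phi (lobj i)).
Proof.
split=> [i j hij x|Q g cog]; first exact: phi_transition_map.
have glue (i j : labelled) x y : phi (lobj i) x = phi (lobj j) y -> g i x = g j y.
  have [_ ub] := directed_labelled; have [k [ik jk]] := ub i j.
  rewrite -(phi_transition_map ik) -(phi_transition_map jk).
  move=> /kernel_factor[o [h [hP hxy]]].
  have [l [kl hE]] := extend_along hP.
  rewrite -(cog _ _ ik) -(cog _ _ jk) -!(cog _ _ kl) /=.
  by rewrite (hE _ _ hxy).
have surj m : {p : {i : labelled & N (lobj i)} | phi (lobj (tag p)) (tagged p) = m}.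
  apply: cid; have [o [x <-]] := phi_surj m.
  have [//|d [p [pP [pG _]]]] := @label_object o [::] (fun=> 0).
  by exists (existT (fun i => N (lobj i)) (Labelled pP pG) x).
pose h m := g (tag (projT1 (surj m))) (tagged (projT1 (surj m))).
have hE i x : h (phi (lobj i) x) = g i x.
  by apply: glue; apply: (projT2 (surj _)).
have hM : nmod_morphism h.
  split=> [|m n].
    have [[i _] _] := directed_labelled.
    by rewrite -(raddf0 (phi (lobj i))) hE raddf0.
  have [[i x] /= <-] := surj m; have [[j y] /= <-] := surj n.
  have [_ ub] := directed_labelled; have [k [ik jk]] := ub i j.
  rewrite -(phi_transition_map ik) -(phi_transition_map jk) -raddfD !hE.
  by rewrite raddfD.
exists (additive_of hM); split=> [i x|h' h'E m]; first exact: hE.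
by have [[i x] /= <-] := surj m; rewrite h'E hE.
Qed.

Lemma direct_limit_criterion :
  (forall o, P (N o)) -> is_direct_limit_of P M.
Proof.
move=> NP; exists labelled_display, labelled, labelled_system.
exists (fun i => phi (lobj i)); split.
- exact: directed_labelled.
- by move=> i; apply: NP.
- exact: labelled_colimit.
Qed.

End DirectLimitCriterion.

(** * Adapted generators for a distributive family of subgroups *)

(** Smith normal form read as a change of generators: the rows of [V]
    express the old generators in terms of the new ones, which the rows of [U]
    define, and the relations become diagonal. *)
Lemma diagonalize_relations (m n : nat) (R : 'M[int]_(m, n)) :
  exists (U V : 'M[int]_n) (d : 'I_n -> nat),
    [/\ V *m U = 1%:M, forall i s, ((d s)%:Z %| (R *m V) i s)%Z &
        forall s, exists y : 'I_m -> int,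
          forall i, (d s)%:Z * U s i = \sum_t y t * R t i].
Proof.
have [L Lu [U Uu [dd _ RE]]] := int_Smith_normal_form R.
set D := \matrix_(_, _) _ in RE.
pose d (s : 'I_n) := if (s < m)%N then absz dd`_s else 0%N.
exists U, (invmx U), d; split; first exact: mulVmx.
  move=> i s; rewrite RE mulmxK // mxE; apply: rpred_sum => t _.
  rewrite mxE; case: eqP => [ts|]; last by rewrite mulr0n mulr0 dvdz0.
  rewrite /d -ts ltn_ord mulr1n; apply: dvdz_mull.
  by rewrite dvdzE abszE absz_nat.
move=> s; rewrite /d; case: ltnP => [sm|_]; last first.
  by exists (fun=> 0) => i; rewrite mul0r big1 // => t _; rewrite mul0r.
pose s' := Ordinal sm; exists (fun t => sgz dd`_s * invmx L s' t) => i.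
have DU : D *m U = invmx L *m R by rewrite RE -mulmxA mulKmx.
have := congr1 (fun A : 'M__ => A s' i) DU; rewrite !mxE.
rewrite (bigD1 s) //= big1 ?addr0; last first.
  by move=> j js; rewrite mxE /= val_eqE eq_sym (negbTE js) mulr0n mul0r.
rewrite mxE eqxx mulr1n => e.
transitivity (sgz dd`_s * (dd`_s * U s i)); first by rewrite mulrA -abszEsg mulrC.
by rewrite e mulr_sumr; apply: eq_bigr => t _; rewrite mulrA.
Qed.

Section DistributiveFamily.
Variables (G : zmodType) (k : nat) (A : {set 'I_k} -> G -> Prop).

Definition is_subgroup (H : G -> Prop) : Prop :=
  H 0 /\ forall x y, H x -> H y -> H (x - y).

Lemma subgroupD H x y : is_subgroup H -> H x -> H y -> H (x + y).
Proof.
move=> [H0 HB] Hx Hy; rewrite -[y]opprK; apply: (HB _ _ Hx).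
by rewrite -[- y]sub0r; apply: HB.
Qed.

Lemma subgroupMz H x n : is_subgroup H -> H x -> H (x *~ n).
Proof.
move=> HH Hx; have [H0 HB] := HH.
have Hn p : H (x *+ p) by elim: p => // p IHp; rewrite mulrS; apply: subgroupD.
case: n => n; first exact: Hn.
by rewrite NegzE mulrNz -sub0r; apply: HB => //; apply: Hn.
Qed.

Lemma subgroup_sum H (I : finType) (Q : pred I) (F : I -> G) :
  is_subgroup H -> (forall i, Q i -> H (F i)) -> H (\sum_(i | Q i) F i).
Proof.
move=> HH HF; elim/big_ind: _ => //; first exact: HH.1.
by move=> x y; apply: subgroupD.
Qed.

Implicit Types (T : {set 'I_k}) (F : {set {set 'I_k}}).

(** The sum of the subgroups [A T], [T] in [F]. *)
Definition subgroup_span F (g : G) : Prop :=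
  exists c : {set 'I_k} -> G, (forall T, T \in F -> A T (c T)) /\
    g = \sum_(T in F) c T.

Hypothesis A_subgroup : forall T, is_subgroup (A T).

Lemma subgroup_span_subgroup F : is_subgroup (subgroup_span F).
Proof.
split=> [|x y [c [cA ->]] [c' [c'A ->]]].
  by exists (fun=> 0); rewrite big1 //; split=> // T _; have [] := A_subgroup T.
exists (fun T => c T - c' T); rewrite sumrB; split=> // T TF.
by have [_ AB] := A_subgroup T; apply: AB; [apply: cA | apply: c'A].
Qed.

Lemma subgroup_span_gen F T g : T \in F -> A T g -> subgroup_span F g.
Proof.
move=> TF Ag; exists (fun T' => if T' == T then g else 0); split=> [T' _|].
  by case: eqP => [->//|_]; have [] := A_subgroup T'.
rewrite -big_mkcondr (big_pred1 T) // => T' /=.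
by case: eqP => [->|_]; rewrite ?TF ?andbF.
Qed.

Lemma subgroup_span_ind F (H : G -> Prop) : is_subgroup H ->
  (forall T g, T \in F -> A T g -> H g) -> forall g, subgroup_span F g -> H g.
Proof.
by move=> HH HA g [c [cA ->]]; apply: subgroup_sum => // T TF; apply: HA (cA T TF).
Qed.

Lemma subgroup_span_mono F F' g :
  F \subset F' -> subgroup_span F g -> subgroup_span F' g.
Proof.
move=> /subsetP FF'; apply: subgroup_span_ind; first exact: subgroup_span_subgroup.
by move=> T h /FF' TF'; apply: subgroup_span_gen.
Qed.

Lemma subgroup_span_setD1 F T g : T \in F -> subgroup_span F g ->
  exists b u, [/\ A T b, subgroup_span (F :\ T) u & g = b + u].
Proof.
move=> TF [c [cA ->]]; exists (c T), (\sum_(T' in F :\ T) c T'); split.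
- exact: cA.
- by exists c; split=> // T'; rewrite inE => /andP[_ /cA].
- by rewrite (big_setD1 T).
Qed.

Hypothesis A_antitone : forall T T' g, T \subset T' -> A T' g -> A T g.
Hypothesis A_distributive : forall T F g d, A T g -> subgroup_span F (g *+ d) ->
  exists2 c, subgroup_span [set T :|: T' | T' in F] c & g *+ d = c *+ d.

(** Induction on [F], removing a member [T] of least cardinality.  Since [F] is
    closed under union, [A T] meets the sum of the other subgroups in a sum of
    subgroups [A T'] with [T'] in [F] strictly larger than [T].  The relations
    [R] between the [a i] give relations between their components in [A T]
    modulo this intersection.  After diagonalization they read
    [q s *+ d s] in the intersection, and purity replaces [q s] by [c s] with
    [c s *+ d s = 0], the difference [e s] going to the larger sets.  The matrix
    [r T] vanishes on the rows [i] outside [T], so that [a i] only involves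
    generators of subgroups [A T] with [i] in [T]. *)
Lemma adapted_generators (m : nat) (R : 'M[int]_(m, k))
    (F : {set {set 'I_k}}) (a : 'I_k -> G) :
    {in F &, forall T T', T :|: T' \in F} ->
    (forall i, subgroup_span [set T in F | i \in T] (a i)) ->
    (forall t, \sum_i a i *~ R t i = 0) ->
  exists (c : {set 'I_k} -> 'I_k -> G) (d : {set 'I_k} -> 'I_k -> nat)
    (r : {set 'I_k} -> 'M[int]_k),
    [/\ forall T s, T \in F -> A T (c T s) /\ c T s *+ d T s = 0,
        forall T i s, i \notin T -> r T i s = 0,
        forall i, a i = \sum_(T in F) \sum_s c T s *~ r T i s &
        forall T t s, T \in F -> ((d T s)%:Z %| (R *m r T) t s)%Z].
Proof.
have [n] := ubnP #|F|; elim: n => // n IHn in F a *.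
rewrite ltnS => leFn FU aF aR.
have [F0|[T0 T0F]] := set_0Vmem F.
  exists (fun _ _ => 0), (fun _ _ => 0%N), (fun _ => 0).
  split=> [T s|T i s _|i|T t s]; rewrite ?F0 ?inE ?mxE //.
  rewrite big_set0; have [c [_ ->]] := aF i.
  by rewrite big1 // => T; rewrite !inE F0 inE.
have [T TF Tmin] : exists2 T, T \in F & forall T', T' \in F -> (#|T| <= #|T'|)%N.
  by case: (arg_minnP (fun T => #|T|) T0F) => T TF Tmin; exists T.
set F' := F :\ T.
have F'P T' : T' \in F' -> T' \in F by rewrite inE => /andP[].
(* every union involving another member of F is strictly larger than T *)
have F'U T1 T' : T1 \in F -> T' \in F' -> T1 :|: T' \in F'.
  move=> T1F; rewrite !inE => /andP[T'T T'F]; rewrite FU // andbT.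
  apply: contra T'T => /eqP TT'; rewrite eqEcard Tmin // andbT.
  by rewrite -TT' subsetUr.
have /choice[bu buP] : forall i, exists bu : G * G,
    [/\ A T bu.1, subgroup_span [set T' in F' | i \in T'] bu.2, a i = bu.1 + bu.2 &
        i \notin T -> bu.1 = 0].
  move=> i; have [iT|iT] := boolP (i \in T).
    have [|b [u [bT uF ->]]] := subgroup_span_setD1 _ (aF i) (T := T).
      by rewrite inE TF.
    exists (b, u); split=> //; apply: subgroup_span_mono uF; apply/subsetP => T'.
    by rewrite !inE => /and3P[-> -> ->].
  exists (0, a i); split; rewrite ?add0r //; first exact: (A_subgroup T).1.
  apply: subgroup_span_mono (aF i); apply/subsetP => T'.
  rewrite !inE => /andP[-> iT'].
  by rewrite iT' !andbT; apply: contra iT => /eqP <-.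
(* b i is the component of a i in A T, and u i is left for the other sets *)
pose b i := (bu i).1; pose u i := (bu i).2.
have bA i : A T (b i) by have [] := buP i.
have uF i : subgroup_span [set T' in F' | i \in T'] (u i) by have [] := buP i.
have aE i : a i = b i + u i by have [] := buP i.
have b0 i : i \notin T -> b i = 0 by have [] := buP i.
have uF' i : subgroup_span F' (u i).
  by apply: subgroup_span_mono (uF i); apply/subsetP => T'; rewrite inE => /andP[].
(* the columns outside T are erased: there b vanishes, and the new coefficients
   must not involve the generators of T *)
pose R0 := \matrix_(t, i) (R t i *+ (i \in T)).
have bR t : \sum_i b i *~ R0 t i = - \sum_i u i *~ R t i.
  apply: (addIr (\sum_i u i *~ R t i)); rewrite addNr -[RHS](aR t) -big_split /=.
  apply: eq_bigr => i _; rewrite mxE aE mulrzDl.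
  by have [_|/b0 ->] := boolP (i \in T); rewrite ?mul0rz.
have [U [V [d [VU dV dU]]]] := diagonalize_relations R0.
pose q s := \sum_i b i *~ U s i.
have qA s : A T (q s).
  by apply: subgroup_sum => // i _; apply: subgroupMz.
have bq i : b i = \sum_s q s *~ V i s.
  rewrite /q; under eq_bigr do rewrite mulrz_suml.
  rewrite exchange_big /= (eq_bigr (fun j => b j *~ (1%:M : 'M[int]_k) i j)).
    rewrite (bigD1 i) //= big1 ?addr0 ?mxE ?eqxx // => j ji.
    by rewrite mxE eq_sym (negbTE ji) mulr0z.
  move=> j _; rewrite -VU mxE mulrz_sumr; apply: eq_bigr => s _.
  by rewrite -mulrzA mulrC.
have qd s : subgroup_span F' (q s *+ d s).
  have [y yP] := dU s.
  have -> : q s *+ d s = \sum_t (\sum_i b i *~ R0 t i) *~ y t.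
    rewrite pmulrn /q mulrz_suml; under [RHS]eq_bigr do rewrite mulrz_suml.
    rewrite exchange_big; apply: eq_bigr => i _ /=.
    rewrite -mulrzA mulrC yP mulrz_sumr; apply: eq_bigr => t _.
    by rewrite -mulrzA mulrC.
  have sF := subgroup_span_subgroup F'.
  apply: subgroup_sum => // t _; apply: subgroupMz => //.
  rewrite bR -sub0r; apply: sF.2; first exact: sF.1.
  by apply: subgroup_sum => // i _; apply: subgroupMz.
have /choice[e eP] : forall s, exists e, subgroup_span [set T :|: T' | T' in F'] e /\
    q s *+ d s = e *+ d s.
  by move=> s; have [e eF ed] := A_distributive (qA s) (qd s); exists e.
have eA s : A T (e s).
  apply: subgroup_span_ind (eP s).1 => // _ g /imsetP[T' _ ->].
  by apply: A_antitone; apply: subsetUl.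
have eF i s : i \in T -> subgroup_span [set T' in F' | i \in T'] (e s).
  move=> iT; apply: subgroup_span_mono (eP s).1.
  apply/subsetP => _ /imsetP[T' T'F ->].
  by rewrite inE F'U // inE iT.
pose c s := q s - e s; pose rT := \matrix_(i, s) (V i s *+ (i \in T)).
have cA s : A T (c s) by apply: (A_subgroup T).2.
have cd s : c s *+ d s = 0 by rewrite mulrnBl (eP s).2 subrr.
have RrT : R *m rT = R0 *m V.
  apply/matrixP => t s; rewrite !mxE; apply: eq_bigr => i _; rewrite !mxE.
  by rewrite mulrnAr mulrnAl.
pose a' i := u i + (if i \in T then \sum_s e s *~ V i s else 0).
have aE' i : a i = \sum_s c s *~ rT i s + a' i.
  rewrite aE /a'; have [iT|iT] := boolP (i \in T); last first.
    rewrite b0 // big1 ?add0r ?addr0 // => s _.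
    by rewrite mxE (negbTE iT) mulr0z.
  rewrite addrCA addrC; congr (_ + _); rewrite bq -big_split /=.
  by apply: eq_bigr => s _; rewrite mxE iT mulr1n -mulrzDl subrK.
have cR t : \sum_i (\sum_s c s *~ rT i s) *~ R t i = 0.
  under eq_bigr do rewrite mulrz_suml; rewrite exchange_big big1 // => s _ /=.
  have -> : \sum_i c s *~ rT i s *~ R t i = c s *~ (R *m rT) t s.
    by rewrite mxE mulrz_sumr; apply: eq_bigr => i _; rewrite mulrC mulrzA.
  rewrite RrT; have /dvdzP[z ->] := dV t s.
  by rewrite mulrC mulrzA -pmulrn cd mul0rz.
have [||||c' [d' [r' [cP' r0' aP' rP']]]] := IHn F' a'.
- by apply: leq_trans leFn; rewrite [#|F|](cardsD1 T) TF.
- by move=> T1 T2 /F'P; apply: F'U.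
- move=> i; apply: subgroupD => //; first exact: subgroup_span_subgroup.
  case: ifP => iT; last exact: (subgroup_span_subgroup _).1.
  apply: subgroup_sum => [|s _]; first exact: subgroup_span_subgroup.
  by apply: subgroupMz; [exact: subgroup_span_subgroup | apply: eF].
- move=> t; rewrite -[RHS](aR t) -[LHS]add0r -[X in X + _](cR t) -big_split /=.
  by apply: eq_bigr => i _; rewrite -mulrzDl -aE'.
exists (fun T' => if T' == T then c else c' T').
exists (fun T' => if T' == T then d else d' T').
exists (fun T' => if T' == T then rT else r' T').
split=> [T' s|T' i s iT'|i|T' t s]; rewrite 1?fun_if.
- case: eqP => [-> //|/eqP T'T T'F]; apply: cP'.
  by rewrite !inE T'T.
- case: eqP iT' => [->|_] iT'; last exact: r0'.
  by rewrite mxE (negbTE iT').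
- rewrite (big_setD1 T) //= eqxx aE'; congr (_ + _); rewrite aP'.
  by apply: eq_bigr => T'; rewrite !inE => /andP[/negbTE ->].
- case: eqP => [->|/eqP T'T] T'F; first by rewrite RrT.
  by apply: rP'; rewrite !inE T'T.
Qed.

End DistributiveFamily.

(** * The group and semilattice coordinates of a regular monoid *)

Section Coordinates.
Variable M : nmodType.
Hypothesis regM : regular M.

Definition inverse (x : M) : M := projT1 (cid (regular_inverse x regM)).

Definition neutral (x : M) : M := x + inverse x.

Lemma neutralDl x : neutral x + x = x.
Proof. by rewrite /neutral /inverse; case: cid => y []. Qed.

Lemma inverse_absorb x : inverse x + x + inverse x = inverse x.
Proof. by rewrite /inverse; case: cid => y []. Qed.

Lemma neutral_uniq e x w : e + x = x -> e = x + w -> e = neutral x.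
Proof.
move=> ex ew.
have -> : e = neutral x + e by rewrite ew addrA neutralDl.
by rewrite addrC /neutral addrA ex.
Qed.

Lemma neutral_idem x : neutral x + neutral x = neutral x.
Proof. by rewrite {2 3}/neutral addrA neutralDl. Qed.

Lemma neutral_is_nmod_morphism : nmod_morphism neutral.
Proof.
split=> [|x y]; first by apply/esym/(@neutral_uniq 0 0 0); rewrite addr0.
apply/esym/(@neutral_uniq _ _ (inverse x + inverse y)).
  by rewrite addrACA !neutralDl.
by rewrite addrACA.
Qed.

HB.instance Definition _ :=
  GRing.isNmodMorphism.Build M M neutral neutral_is_nmod_morphism.

Lemma neutralD x y : neutral (x + y) = neutral x + neutral y.
Proof. exact: raddfD. Qed.

Lemma neutral0 : neutral 0 = 0.
Proof. exact: raddf0. Qed.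

Lemma neutralK x : neutral (neutral x) = neutral x.
Proof.
by apply/esym/(@neutral_uniq _ _ 0); rewrite ?addr0 ?neutral_idem.
Qed.

Lemma neutral_inverse x : neutral (inverse x) = neutral x.
Proof.
apply/esym/(@neutral_uniq _ _ x); last by rewrite /neutral addrC.
by rewrite /neutral [x + _]addrC inverse_absorb.
Qed.

(** The preorder only sees the idempotent coordinate. *)
Lemma alg_leP (x y : M) : alg_le x y <-> neutral x + neutral y = neutral y.
Proof.
split=> [[z <-]|e]; first by rewrite neutralD addrA neutral_idem.
exists (inverse x + y); rewrite addrA -/(neutral x).
by rewrite -{1}[y]neutralDl addrA e neutralDl.
Qed.

Lemma alg_leDl (x y z : M) : alg_le x z -> alg_le y z -> alg_le (x + y) z.
Proof.
move=> /alg_leP xz /alg_leP yz; apply/alg_leP.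
by rewrite neutralD -addrA yz.
Qed.

Lemma alg_le_sum (I : finType) (P : pred I) (f : I -> M) (z : M) :
  (forall i, P i -> alg_le (f i) z) -> alg_le (\sum_(i | P i) f i) z.
Proof.
move=> fz; elim/big_ind: _ => // [|x y]; last exact: alg_leDl.
by exists z; rewrite add0r.
Qed.

Lemma alg_le_neutral x x' y :
  neutral x = neutral x' -> alg_le x y -> alg_le x' y.
Proof. by rewrite !alg_leP => ->. Qed.

Lemma neutral_anti (x y : M) : alg_le x y -> alg_le y x -> neutral x = neutral y.
Proof. by move=> /alg_leP xy /alg_leP yx; rewrite -xy addrC yx. Qed.

Lemma neutralMn x n : (0 < n)%N -> neutral (x *+ n) = neutral x.
Proof. by move=> n0; rewrite raddfMn /= idempotent_mulrn ?neutral_idem. Qed.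

Section GroupCoordinate.
Variables (G : zmodType) (g : {additive M -> G}).
Hypothesis gP : forall x y, g x = g y <-> exists c, x + c = y + c.
Hypothesis canM : cancellative_below M.

Lemma g_neutral x : g (neutral x) = 0.
Proof. by apply: (addIr (g x)); rewrite -raddfD neutralDl add0r. Qed.

Lemma g_inverse x : g (inverse x) = - g x.
Proof. by apply: (addrI (g x)); rewrite -raddfD g_neutral subrr. Qed.

(** This is where [emb] enters: [M] embeds in the product of its semilattice
    of idempotents and its Grothendieck group. *)
Lemma coordinates_inj x y : neutral x = neutral y -> g x = g y -> x = y.
Proof.
move=> exy /gP[c xcyc].
have xy : x + (inverse x + y) = y by rewrite addrA -/(neutral x) exy neutralDl.
have yx : y + (inverse y + x) = x by rewrite addrA -/(neutral y) -exy neutralDl.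
have := @canM x (inverse x + y) (inverse y + x) c.
by rewrite xy yx => ->.
Qed.

(** Multiples in the group of [x]: the value at [0] is the neutral element of
    that group, not the zero of [M]. *)
Definition zmul (z : int) (x : M) : M :=
  match z with Posz n => x *+ n + neutral x | Negz n => inverse x *+ n.+1 end.

Lemma neutral_zmul z x : neutral (zmul z x) = neutral x.
Proof.
case: z => n /=; last by rewrite neutralMn // neutral_inverse.
rewrite neutralD neutralK; case: n => [|n]; first by rewrite mulr0n neutral0 add0r.
by rewrite neutralMn // neutral_idem.
Qed.

Lemma g_zmul z x : g (zmul z x) = g x *~ z.
Proof.
case: z => n /=; first by rewrite raddfD raddfMn g_neutral addr0 pmulrn.
by rewrite raddfMn g_inverse NegzE mulrNz mulNrn pmulrn.
Qed.

Hypothesis refM : refinement M.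
Hypothesis conM : conical M.
Hypothesis rootM : root_closed_below M.

Lemma riesz_decomposition (I : finType) (F : {set I}) (y : I -> M) x :
  alg_le x (\sum_(i in F) y i) ->
  exists c : I -> M,
    (forall i, i \in F -> alg_le (c i) (y i)) /\ x = \sum_(i in F) c i.
Proof.
have [n] := ubnP #|F|; elim: n => // n IHn in F x *; rewrite ltnS => leFn.
have [->|[i iF]] := set_0Vmem F.
  rewrite big_set0 => -[z /conM[-> _]]; exists (fun=> 0); rewrite big_set0.
  by split=> // i; rewrite inE.
rewrite (big_setD1 i) //= => -[z /refM[c00 [c01 [c10 [c11 [-> _ yE sE]]]]]].
have [|| c [cy ->]] := IHn (F :\ i) c01.
- by apply: leq_trans leFn; rewrite [#|F|](cardsD1 i) iF.
- by exists c11.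
exists (fun j => if j == i then c00 else c j); split=> [j jF|].
  by case: eqP => [->|/eqP ji]; [exists c10 | apply: cy; rewrite !inE ji].
rewrite [RHS](big_setD1 i) //= eqxx; congr (_ + _).
by apply: eq_bigr => j; rewrite !inE => /andP[/negbTE ->].
Qed.

(** The subgroups of [G] cut out by two elements intersect in the subgroup cut
    out by their common minorants. *)
Lemma common_minorant x y : g x = g y ->
  exists c, [/\ alg_le c x, alg_le c y & g c = g x].
Proof.
move=> gxy; have : x + neutral y = neutral x + y.
  apply: coordinates_inj; first by rewrite !(neutralK, neutralD).
  by rewrite !(g_neutral, raddfD) addr0 add0r.
move=> /refM[c00 [c01 [c10 [c11 [xE yE ex ey]]]]].
have le_nx z w : alg_le z (neutral w) -> alg_le z w.
  by rewrite !alg_leP neutralK.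
have c10x : alg_le c10 x by apply: le_nx; rewrite ex; apply: alg_le_addl.
have c10y : alg_le c10 y by apply: le_nx; rewrite yE; apply: alg_le_addr.
exists (c01 + inverse c10); split.
- apply: alg_leDl; first by rewrite {1}xE; apply: alg_le_addl.
  by apply: alg_le_neutral c10x; rewrite neutral_inverse.
- apply: alg_leDl; first by rewrite {1}ey; apply: alg_le_addr.
  by apply: alg_le_neutral c10y; rewrite neutral_inverse.
have := g_neutral x; rewrite ex raddfD => /eqP; rewrite addr_eq0 => /eqP c00E.
by rewrite raddfD g_inverse xE raddfD c00E addrC.
Qed.

(** Purity in the form of roots in [G]: an [n]-th root of the class of [y] that
    comes from anywhere in [M] can be replaced by one from the group of [y]. *)
Lemma root_in_group (n : nat) x y : g y = g x *+ n ->
  exists w, neutral w = neutral y /\ g y = g w *+ n.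
Proof.
case: n => [|n] gyx; first by exists y; rewrite gyx mulr0n.
pose x1 := x + neutral y.
have nx1 : neutral x1 = neutral x + neutral y by rewrite neutralD neutralK.
have gx1 : g x1 = g x by rewrite raddfD g_neutral addr0.
have e : y + (x1 + inverse x1) = x1 *+ n.+1.
  rewrite -/(neutral x1); apply: coordinates_inj.
    by rewrite neutralMn // [LHS]neutralD neutralK nx1 addrCA neutral_idem.
  by rewrite raddfMn gx1 raddfD g_neutral addr0.
have [w yw] := @rootM n.+1 x1 _ y isT (neutralDl x1) e.
by exists w; rewrite yw neutralMn // raddfMn.
Qed.

Section SubgroupFamily.
Variables (k : nat) (a : 'I_k -> M).
Implicit Types (T : {set 'I_k}) (F : {set {set 'I_k}}).

Definition minorant T (x : M) : Prop := forall i, i \in T -> alg_le x (a i).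

Definition minorant_group T (h : G) : Prop := exists2 x, minorant T x & g x = h.

Lemma minorant_group_subgroup T : is_subgroup (minorant_group T).
Proof.
split=> [|_ _ [x xT <-] [y yT <-]].
  by exists 0; rewrite ?raddf0 // => i _; exists (a i); rewrite add0r.
exists (x + inverse y); last by rewrite raddfD g_inverse.
move=> i iT; apply: alg_leDl; first exact: xT.
by apply: alg_le_neutral (yT i iT); rewrite neutral_inverse.
Qed.

Lemma minorant_group_antitone T T' h :
  T \subset T' -> minorant_group T' h -> minorant_group T h.
Proof.
by move=> /subsetP TT' [x xT' <-]; exists x => // i /TT'; apply: xT'.
Qed.

(** Distributivity and purity in one statement; [d = 1] gives the distributive
    law.  The classes of [b *~ d] and of the sum of the [y T'] agree, hence are
    the class of a common minorant; purity extracts a [d]-th root [w] in its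
    group, and [w] is split along the sum of the [y T'] by refinement. *)
Lemma minorant_group_distributive T F h d :
    minorant_group T h -> subgroup_span minorant_group F (h *+ d) ->
  exists2 c, subgroup_span minorant_group [set T :|: T' | T' in F] c &
    h *+ d = c *+ d.
Proof.
move=> [b bT <-] [c [cA cE]].
have /choice[y yP] : forall T', exists y, T' \in F -> minorant T' y /\ g y = c T'.
  move=> T'; have [/cA[y yT' gy]|T'F] := boolP (T' \in F); first by exists y.
  by exists 0 => T'F'; case/negP: T'F.
have gby : g (zmul d%:Z b) = g (\sum_(T' in F) y T').
  rewrite g_zmul raddf_sum -pmulrn cE; apply: eq_bigr => T' T'F.
  by have [] := yP T' T'F.
have [m [mb my gm]] := common_minorant gby.
have [|w [nw gw]] := @root_in_group d b m; first by rewrite gm g_zmul pmulrn.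
have wb : alg_le w b.
  apply: alg_le_neutral (esym nw) _.
  by move: mb; rewrite !alg_leP neutral_zmul.
have wy : alg_le w (\sum_(T' in F) y T') by apply: alg_le_neutral (esym nw) my.
have [v [vy wE]] := riesz_decomposition wy.
exists (g w); last by rewrite -gw gm g_zmul pmulrn.
rewrite wE raddf_sum.
apply: subgroup_sum => [|T' T'F].
  by apply: subgroup_span_subgroup; apply: minorant_group_subgroup.
apply: (@subgroup_span_gen _ _ _ _ _ (T :|: T')).
  exact: minorant_group_subgroup.
  exact: imset_f.
exists (v T') => // i; rewrite inE => /orP[iT|iT'].
  apply: alg_le_trans (bT i iT); apply: alg_le_trans wb.
  by rewrite wE (big_setD1 T') //=; apply: alg_le_addr.
by apply: alg_le_trans (vy T' T'F) _; apply: (yP T' T'F).1.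
Qed.

End SubgroupFamily.
End GroupCoordinate.
End Coordinates.

(** * Finite sums of cyclic groups with a zero adjoined *)

(** The cyclic group with [d] elements, infinite for [d = 0]: the possible
    images of its generator in a group are always the elements killed by [d]. *)
Definition cyclic (d : nat) : zmodType := if d is n.+1 then 'I_n.+1 else int.

Definition residue (d : nat) : int -> cyclic d :=
  match d with 0%N => id | n.+1 => fun z => (inZp 1 : 'I_n.+1) *~ z end.

Definition repr_residue (d : nat) : cyclic d -> int :=
  match d with 0%N => id | n.+1 => fun x : 'I_n.+1 => Posz x end.

Lemma residueD d m n : residue d (m + n) = residue d m + residue d n.
Proof. by case: d => [|d] //=; rewrite mulrzDr. Qed.

Lemma residue0 d : residue d 0 = 0.
Proof. by case: d. Qed.

Lemma residueB d m n : residue d (m - n) = residue d m - residue d n.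
Proof. by apply: (addIr (residue d n)); rewrite -residueD !subrK. Qed.

Lemma residue_sum d (I : finType) (P : pred I) (f : I -> int) :
  residue d (\sum_(i | P i) f i) = \sum_(i | P i) residue d (f i).
Proof. by apply: (big_morph _ (residueD d) (residue0 d)). Qed.

Lemma repr_residueK d : cancel (@repr_residue d) (@residue d).
Proof.
case: d => [|d] //= x; rewrite -pmulrn Zp_mulrn; apply: val_inj => /=.
by rewrite modnMml mul1n modn_small.
Qed.

Lemma residue_eq0 d z : residue d z = 0 <-> (d%:Z %| z)%Z.
Proof.
case: d => [|d] /=; first by rewrite dvd0z; split=> [->|/eqP].
have posE n : (inZp 1 : 'I_d.+1) *~ Posz n = 0 <-> (d.+1 %| n)%N.
  rewrite -pmulrn Zp_mulrn; split=> [/(congr1 val) /= e|dn].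
    by rewrite /dvdn -e modnMml mul1n.
  by apply: val_inj; rewrite /= modnMml mul1n; apply/eqP.
case: z => n; first exact: posE.
rewrite NegzE mulrNz rpredN; split=> [/eqP|/posE ->]; last by rewrite oppr0.
by rewrite oppr_eq0 => /eqP/posE.
Qed.

Lemma residue_eq d m n : residue d m = residue d n <-> (d%:Z %| m - n)%Z.
Proof.
rewrite -residue_eq0 residueB.
by split=> [->|/eqP]; rewrite ?subrr ?subr_eq0 // => /eqP.
Qed.

Lemma mulrz_residue (G : zmodType) (x : G) d z :
  x *+ d = 0 -> x *~ repr_residue (residue d z) = x *~ z.
Proof.
move=> xd; apply/eqP; rewrite -subr_eq0 -mulrzBr.
have /residue_eq/dvdzP[q ->] := repr_residueK (residue d z).
by rewrite mulrC mulrzA -pmulrn xd mul0rz.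
Qed.

(** A map from a group to a commutative monoid that preserves sums has a group
    as its range, and the neutral element and the inverses in that group are
    determined by any one generator. *)
Lemma semigroup_hom_int_eq (M : nmodType) (f f' : int -> M) :
    {morph f : m n / m + n} -> {morph f' : m n / m + n} -> f 1 = f' 1 ->
  f =1 f'.
Proof.
have absorb (h h' : int -> M) : {morph h : m n / m + n} ->
    {morph h' : m n / m + n} -> h 1 = h' 1 -> h 0 = h' 0 + h 0.
  move=> hD h'D e; have h1 : h' 0 + h 1 = h 1 by rewrite e -h'D add0r.
  have h0 : h 0 = h 1 + h (- 1) by rewrite -hD subrr.
  by rewrite h0 addrA h1.
move=> fD f'D f1.
have f0 : f 0 = f' 0.
  by rewrite (absorb f f') // [RHS](absorb f' f) // addrC.
have fn n : f (Posz n) = f' (Posz n).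
  by elim: n => // n IHn; rewrite -addn1 PoszD fD f'D IHn f1.
case=> n //; rewrite NegzE; set z := Posz n.+1.
transitivity (f (- z) + (f z + f' (- z))).
  by rewrite fn -f'D subrr -f0 -fD addr0.
by rewrite addrA -fD addNr f0 -f'D add0r.
Qed.

Section CyclicSum.
Variables (k : nat) (d : 'I_k -> nat).

Definition cyclic_sum : nmodType :=
  direct_sum (fun i : 'I_k => adjoin_zero (cyclic (d i)) : nmodType).

Lemma finite_sum_of_basic_cyclic_sum : finite_sum_of_basic cyclic_sum.
Proof.
have iso_refl (N : nmodType) : nmod_isomorphic N N.
  by exists idfun; exists idfun.
exists k, (fun i => adjoin_zero (cyclic (d i)) : nmodType); split=> // i.
by case: (d i) => [|n]; [right | left; exists n].
Qed.

Definition weight e (o : adjoin_zero (cyclic e)) : int :=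
  if o is Some x then repr_residue x else 0.

Definition multiple_gen (i : 'I_k) (z : int) : cyclic_sum :=
  [ffun j => (if j == i then Some (residue (d j) z) else None)
             : adjoin_zero (cyclic (d j))].

Lemma multiple_genD i m n :
  multiple_gen i (m + n) = multiple_gen i m + multiple_gen i n.
Proof.
apply/ffunP => j; rewrite direct_sumD !ffunE; case: eqP => // _.
by rewrite residueD.
Qed.

Lemma cyclic_sumE (x : cyclic_sum) :
  x = \sum_(i | isSome (x i)) multiple_gen i (weight (x i)).
Proof.
apply/ffunP => j.
have sumE (P : pred 'I_k) (f : 'I_k -> cyclic_sum) :
    (\sum_(i | P i) f i) j = \sum_(i | P i) f i j.
  by elim/big_rec2: _ => [|i u v _ <-]; rewrite ?direct_sum0 ?direct_sumD.
rewrite sumE big_mkcond (bigD1 j) //= big1 ?addr0; last first.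
  by move=> i ij; case: isSome => //; rewrite ffunE eq_sym (negbTE ij).
by rewrite ffunE eqxx; case: (x j) => //= z; rewrite repr_residueK.
Qed.

Definition cyclic_gens : seq cyclic_sum := [seq multiple_gen i 1 | i : 'I_k].


Lemma cyclic_gens_epi (M : nmodType) (h h' : {additive cyclic_sum -> M}) :
  {in cyclic_gens, h =1 h'} -> h =1 h'.
Proof.
move=> hh' x; rewrite (cyclic_sumE x) !raddf_sum; apply: eq_bigr => i _.
apply: (@semigroup_hom_int_eq M (h \o multiple_gen i) (h' \o multiple_gen i)).
- by move=> m n /=; rewrite multiple_genD raddfD.
- by move=> m n /=; rewrite multiple_genD raddfD.
- by apply: hh'; apply: image_f.
Qed.

End CyclicSum.

Lemma residue_weightD e (o o' : adjoin_zero (cyclic e)) :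
  residue e (weight (o + o')) = residue e (weight o + weight o').
Proof.
rewrite residueD; case: o o' => [x|] [y|] /=;
  by rewrite ?residue0 ?repr_residueK ?addr0 ?add0r.
Qed.

Lemma isSomeD (G : zmodType) (o o' : adjoin_zero G) :
  isSome (o + o') = isSome o || isSome o'.
Proof. by case: o o' => [x|] [y|]. Qed.

(** A homomorphism between sums of cyclic groups with zeros adjoined is given by
    the relation [S] of supports and by an integer matrix [r]. *)
Section MatrixMap.
Variables (k k' : nat) (d : 'I_k -> nat) (d' : 'I_k' -> nat).
Variables (S : 'I_k -> 'I_k' -> bool) (r : 'I_k -> 'I_k' -> int).
Hypothesis dvd_r : forall i j, S i j -> ((d' j)%:Z %| (d i)%:Z * r i j)%Z.

Definition matrix_fun (x : cyclic_sum d) : cyclic_sum d' :=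
  [ffun j => (if [exists i, S i j && isSome (x i)]
              then Some (residue (d' j) (\sum_(i | S i j) r i j * weight (x i)))
              else None) : adjoin_zero (cyclic (d' j))].

Lemma matrix_fun_is_nmod_morphism : nmod_morphism matrix_fun.
Proof.
split=> [|x y]; apply/ffunP => j.
  rewrite direct_sum0 ffunE; case: existsP => // -[i].
  by rewrite direct_sum0 andbF.
rewrite direct_sumD !ffunE.
have -> : [exists i, S i j && isSome ((x + y) i)] =
    [exists i, S i j && isSome (x i)] || [exists i, S i j && isSome (y i)].
  apply/existsP/orP => [[i]|[] /existsP[i /andP[Sij xi]]].
  - rewrite direct_sumD isSomeD => /andP[Sij /orP[]] xi; [left|right];
      by apply/existsP; exists i; rewrite Sij.
  - by exists i; rewrite direct_sumD isSomeD Sij xi.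
  - by exists i; rewrite direct_sumD isSomeD Sij xi orbT.
have -> : residue (d' j) (\sum_(i | S i j) r i j * weight ((x + y) i)) =
    residue (d' j) (\sum_(i | S i j) r i j * weight (x i)) +
    residue (d' j) (\sum_(i | S i j) r i j * weight (y i)).
  rewrite -residueD -big_split !residue_sum; apply: eq_bigr => i Sij /=.
  rewrite -mulrDr direct_sumD; apply/residue_eq; rewrite -mulrBr.
  have /residue_eq/dvdzP[q ->] := residue_weightD (x i) (y i).
  by rewrite mulrCA [r i j * _]mulrC; apply: dvdz_mull; apply: dvd_r.
have noterm (z : cyclic_sum d) : ~~ [exists i, S i j && isSome (z i)] ->
    residue (d' j) (\sum_(i | S i j) r i j * weight (z i)) = 0.
  rewrite negb_exists => /forallP zj; rewrite big1 ?residue0 // => i Sij.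
  by have := zj i; rewrite Sij; case: (z i) => // _; rewrite mulr0.
have [xj|/noterm ->] := boolP [exists i, S i j && isSome (x i)];
have [yj|/noterm ->] := boolP [exists i, S i j && isSome (y i)] => //=.
- by rewrite addr0.
- by rewrite add0r.
Qed.

Definition matrix_map : {additive cyclic_sum d -> cyclic_sum d'} :=
  additive_of matrix_fun_is_nmod_morphism.

End MatrixMap.

(** * Factoring maps out of sums of cyclic groups with a zero adjoined *)

Section Factorization.
Variable M : nmodType.
Hypothesis regM : regular M.
Hypotheses (conM : conical M) (refM : refinement M).
Hypotheses (canM : cancellative_below M) (rootM : root_closed_below M).
Variables (G : zmodType) (g : {additive M -> G}).
Hypothesis gP : forall x y, g x = g y <-> exists c, x + c = y + c.

Local Notation neutral := (neutral regM).
Local Notation zmul := (zmul regM).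
Local Notation coordinates_inj := (coordinates_inj (regM := regM) gP canM).

(** A finite sum of cyclic groups with zeros adjoined, together with a map to
    [M] given by the images [mark i] of the generators. *)
Record marked_sum := MarkedSum {
  rank : nat;
  torsion : 'I_rank -> nat;
  mark : 'I_rank -> M;
  mark_torsion : forall i, g (mark i) *+ torsion i = 0
}.

Local Notation dom o := (cyclic_sum (@torsion o)).

Section Evaluation.
Variable o : marked_sum.

Definition eval_fun (x : dom o) : M :=
  \sum_(i | isSome (x i)) zmul (weight (x i)) (mark i).

Lemma neutral_eval x :
  neutral (eval_fun x) = \sum_(i | isSome (x i)) neutral (mark i).
Proof. by rewrite raddf_sum; apply: eq_bigr => i _; apply: neutral_zmul. Qed.

Lemma g_eval x : g (eval_fun x) = \sum_i g (mark i) *~ weight (x i).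
Proof.
rewrite raddf_sum big_mkcond; apply: eq_bigr => i _.
by case: (x i) => [z|] //=; rewrite g_zmul.
Qed.

Lemma mark_weightD i (u v : adjoin_zero (cyclic (torsion i))) :
  g (mark i) *~ weight (u + v) = g (@mark o i) *~ weight u + g (mark i) *~ weight v.
Proof.
rewrite -mulrzDr -(mulrz_residue _ (mark_torsion i)) residue_weightD.
by rewrite mulrz_residue // mark_torsion.
Qed.

Lemma eval_is_nmod_morphism : nmod_morphism eval_fun.
Proof.
split=> [|x y].
  by rewrite /eval_fun big1 // => i; rewrite direct_sum0.
apply: coordinates_inj.
  rewrite neutralD !neutral_eval big_mkcond [X in _ = X + _]big_mkcond.
  rewrite [X in _ = _ + X]big_mkcond -big_split; apply: eq_bigr => i _ /=.
  rewrite direct_sumD isSomeD.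
  by case: isSome; case: isSome; rewrite ?neutral_idem ?addr0 ?add0r.
rewrite raddfD /= !g_eval -big_split; apply: eq_bigr => i _ /=.
by rewrite direct_sumD mark_weightD.
Qed.

Definition eval : {additive dom o -> M} := additive_of eval_is_nmod_morphism.

End Evaluation.

(** Only the generators have to be compared, and in [M] this can be done
    coordinatewise. *)
Lemma matrix_map_eval (o o' : marked_sum)
    (S : 'I_(rank o) -> 'I_(rank o') -> bool)
    (r : 'I_(rank o) -> 'I_(rank o') -> int)
    (dvd_r : forall i j, S i j -> ((torsion j)%:Z %| (torsion i)%:Z * r i j)%Z) :
    (forall i, neutral (mark i) = \sum_(j | S i j) neutral (mark j)) ->
    (forall i, g (mark i) = \sum_(j | S i j) g (mark j) *~ r i j) ->
  forall x : dom o, eval o' (matrix_map dvd_r x) = eval o x.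
Proof.
move=> nS gS; suff : eval o' \o matrix_map dvd_r =1 eval o by [].
apply: cyclic_gens_epi => _ /imageP[i _ ->] /=.
have genE j : isSome (multiple_gen (@torsion o) i 1 j) = (j == i).
  by rewrite ffunE; case: eqP.
have Sgen j :
    [exists i', S i' j && isSome (multiple_gen (@torsion o) i 1 i')] = S i j.
  apply/existsP/idP => [[i']|Sij]; first by rewrite genE => /andP[Si /eqP <-].
  by exists i; rewrite Sij genE eqxx.
apply: coordinates_inj.
  rewrite !neutral_eval (eq_bigl (pred1 i)) // big_pred1_eq nS.
  by apply: eq_bigl => j; rewrite ffunE Sgen; case: (S i j).
rewrite !g_eval (bigD1 i) //= [X in _ = _ + X]big1 ?addr0; last first.
  by move=> j ji; rewrite ffunE (negbTE ji).
rewrite [in RHS]ffunE eqxx /= mulrz_residue ?mark_torsion // gS [RHS]big_mkcond /=.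
apply: eq_bigr => j _; rewrite ffunE Sgen.
case Sij : (S i j) => //=; rewrite mulrz_residue ?mark_torsion //.
rewrite (bigD1 i) //= big1 ?addr0; last first.
  by move=> i' /andP[_ i'i]; rewrite ffunE (negbTE i'i) mulr0.
rewrite ffunE eqxx /= mulrzA mulrz_residue //.
have /dvdzP[q qE] := dvd_r i j Sij.
by rewrite pmulrn -mulrzA mulrC qE mulrC mulrzA -pmulrn mark_torsion mul0rz.
Qed.

Lemma eval_surj (m : M) : exists o (x : dom o), eval o x = m.
Proof.
have m0 (i : 'I_1) : g m *+ 0 = 0 by [].
exists (@MarkedSum 1 (fun=> 0%N) (fun=> m) m0).
exists ([ffun i => Some 1 : adjoin_zero (cyclic 0)]).
apply: coordinates_inj; rewrite ?neutral_eval ?g_eval.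
  by rewrite (eq_bigl xpredT) ?big_ord1 // => i; rewrite ffunE.
by rewrite big_ord1 ffunE.
Qed.

Lemma eval_joint_factor (o1 o2 : marked_sum) : exists o
  (h1 : {additive dom o1 -> dom o}) (h2 : {additive dom o2 -> dom o}),
  (forall x, eval o (h1 x) = eval o1 x) /\ (forall x, eval o (h2 x) = eval o2 x).
Proof.
pose d (s : 'I_(rank o1) + 'I_(rank o2)) :=
  match s with inl i => torsion i | inr i => torsion i end.
pose a (s : 'I_(rank o1) + 'I_(rank o2)) :=
  match s with inl i => mark i | inr i => mark i end.
have ad i : g (a (split i)) *+ d (split i) = 0.
  by case: (split i) => j; apply: mark_torsion.
pose o := MarkedSum ad.
have split_l i : split (lshift (rank o2) i) = inl i := unsplitK (inl i).
have split_r i : split (rshift (rank o1) i) = inr i := unsplitK (inr i).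
have dvd1 i j : j == lshift (rank o2) i ->
    ((@torsion o j)%:Z %| (torsion i)%:Z * 1)%Z.
  by move/eqP->; rewrite /= split_l mulr1 /= dvdzz.
have dvd2 i j : j == rshift (rank o1) i ->
    ((@torsion o j)%:Z %| (torsion i)%:Z * 1)%Z.
  by move/eqP->; rewrite /= split_r mulr1 /= dvdzz.
exists o, (matrix_map dvd1), (matrix_map dvd2); split.
  by apply: matrix_map_eval => i; rewrite big_pred1_eq /= split_l.
by apply: matrix_map_eval => i; rewrite big_pred1_eq /= split_r.
Qed.


Section Kernel.
Variable (o : marked_sum).
Local Notation k := (rank o).
Local Notation a := (@mark o).
Implicit Types (X Y : pred 'I_k) (T : {set 'I_k}).

Definition meets X T : bool := [exists i in T, X i].

Lemma meetsU X T T' : meets X (T :|: T') = meets X T || meets X T'.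
Proof.
apply/exists_inP/orP => [[i]|[] /exists_inP[i iT Xi]].
- by rewrite inE => /orP[] iT Xi; [left|right]; apply/exists_inP; exists i.
- by exists i => //; rewrite inE iT.
- by exists i => //; rewrite inE iT orbT.
Qed.

Lemma meets1 X i : meets X [set i] = X i.
Proof.
by apply/exists_inP/idP => [[j /set1P ->]|Xi] //; exists i; rewrite ?inE.
Qed.

(** The sets whose components have the same status for [X] and [Y]: with [X] and
    [Y] the supports of two elements, both or neither of them reach the summands
    attached to [T]. *)
Definition balanced X Y : {set {set 'I_k}} := [set T | meets X T == meets Y T].

Lemma balancedC X Y : balanced X Y = balanced Y X.
Proof. by apply/setP => T; rewrite !inE eq_sym. Qed.

Lemma balancedU X Y : {in balanced X Y &, forall T T', T :|: T' \in balanced X Y}.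
Proof. by move=> T T'; rewrite !inE !meetsU => /eqP -> /eqP ->. Qed.

(** If [i] is in [X] but not in [Y], the set [[set i]] is not balanced; then
    [a i] lies below the sum of the [a j], [j] in [Y], and splits into minorants
    of the pairs [[set i; j]], which meet both [X] and [Y]. *)
Lemma balanced_cover X Y i :
    \sum_(j | X j) neutral (a j) = \sum_(j | Y j) neutral (a j) ->
  exists y : {set 'I_k} -> M,
    (forall T, minorant a T (y T)) /\
    a i = \sum_(T in [set T in balanced X Y | i \in T]) y T.
Proof.
(* it is enough to split a i into minorants of pairs {i, j} that are balanced *)
suff main X' Y' : \sum_(j | X' j) neutral (a j) = \sum_(j | Y' j) neutral (a j) ->
    Y' i ==> X' i -> exists (J : {set 'I_k}) (b : 'I_k -> M),
      (forall j, j \in J -> [/\ alg_le (b j) (a i), alg_le (b j) (a j) &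
         [set i; j] \in balanced X' Y']) /\ a i = \sum_(j in J) b j.
  move=> XY; have [J [b [bP aE]]] : exists (J : {set 'I_k}) (b : 'I_k -> M),
      (forall j, j \in J -> [/\ alg_le (b j) (a i), alg_le (b j) (a j) &
         [set i; j] \in balanced X Y]) /\ a i = \sum_(j in J) b j.
    have [Yi|Yi] := boolP (Y i ==> X i); first exact: main.
    rewrite balancedC; apply: main => //.
    by move: Yi; rewrite negb_imply => /andP[-> _]; rewrite implybT.
  exists (fun T => \sum_(j in J | [set i; j] == T) b j); split=> [T|].
    move=> l lT; apply: (alg_le_sum regM) => j /andP[/bP[ji jj _] /eqP TE].
    by move: lT; rewrite -TE !inE => /orP[] /eqP ->.
  rewrite aE; apply: partition_big => j /bP[_ _ ij].
  by rewrite inE ij !inE eqxx.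
move=> XY; have [XYi _|XYi YXi] := eqVneq (X' i) (Y' i).
  exists [set i], (fun=> a i); rewrite big_set1; split=> // j /set1P ->.
  by split; rewrite ?inE ?meetsU ?meets1 ?XYi //; apply: alg_le_refl.
have [Xi Yi] : X' i /\ ~~ Y' i by case: (X' i) (Y' i) XYi YXi => [] [].
have [|b [bj aE]] := @riesz_decomposition _ refM conM _ [set j | Y' j] a (a i).
  apply/(alg_leP regM); rewrite raddf_sum (eq_bigl Y') => [|j]; last by rewrite inE.
  by rewrite /= -XY (bigD1 i) //= addrA neutral_idem.
exists [set j | Y' j], b; split=> // j jY; split; last 1 first.
- by rewrite inE !meetsU !meets1 Xi; move: jY; rewrite inE => ->; rewrite orbT.
- by rewrite aE (big_setD1 j) //=; apply: alg_le_addr.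
- exact: bj.
Qed.

(** The summands of the new object are the adapted generators for the balanced
    sets, for the torsion relations of the generators of [o] and the relation
    [z] expressing the equality in [G].  As the adapted generators may be too
    small for their neutral elements to add up to those of the [a i], each set
    [T] also gets a summand with trivial group at [neutral (top T)]. *)
Lemma eval_kernel_factor (x y : dom o) : eval o x = eval o y ->
  exists o' (h : {additive dom o -> dom o'}),
    (forall w, eval o' (h w) = eval o w) /\ h x = h y.
Proof.
move=> exy; pose X i := isSome (x i); pose Y i := isSome (y i).
have XY : \sum_(i | X i) neutral (a i) = \sum_(i | Y i) neutral (a i).
  by rewrite -!neutral_eval [X in neutral X]exy.
pose z i := weight (x i) - weight (y i).
have gz : \sum_i g (a i) *~ z i = 0.
  apply/eqP; under eq_bigr do rewrite mulrzBr.
  by rewrite sumrB subr_eq0 -!g_eval; apply/eqP; congr (g _).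
pose F := balanced X Y.
have /choice[cov covP] := fun i => balanced_cover i XY.
pose R := col_mx (\matrix_(i < k, j < k) ((torsion i)%:Z *+ (i == j)))
                 (\row_j z j).
have [|||c [d [r [cP r0 cE rP]]]] := @adapted_generators G k (minorant_group g a)
    (minorant_group_subgroup regM g a) (@minorant_group_antitone M G g k a)
    (@minorant_group_distributive M regM G g gP canM refM conM rootM k a)
    _ R F (fun i => g (a i)).
- exact: balancedU.
- move=> i; have [yT ->] := covP i; rewrite raddf_sum.
  apply: subgroup_sum => [|T TF].
    by apply: subgroup_span_subgroup; apply: minorant_group_subgroup.
  apply: subgroup_span_gen TF _; first exact: minorant_group_subgroup.
  by exists (cov i T).
- move=> t; rewrite -[t]splitK /unsplit; case: (split t) => [i|j].
    rewrite (bigD1 i) //= big1 => [|j ji].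
      by rewrite col_mxEu mxE eqxx mulr1n -pmulrn mark_torsion addr0.
    by rewrite col_mxEu mxE eq_sym (negbTE ji) mulr0n mulr0z.
  by rewrite -[RHS]gz; apply: eq_bigr => i _; rewrite col_mxEd mxE.
have rP1 T i s : T \in F -> ((d T s)%:Z %| (torsion i)%:Z * r T i s)%Z.
  move=> TF; have := rP T (lshift 1 i) s TF; rewrite mul_col_mx col_mxEu mxE.
  rewrite (bigD1 i) //= big1 ?addr0 ?mxE ?eqxx // => l li.
  by rewrite mxE eq_sym (negbTE li) mulr0n mul0r.
have rP2 T s : T \in F -> ((d T s)%:Z %| \sum_(i in T) r T i s * z i)%Z.
  move=> TF; have := rP T (rshift k ord0) s TF; rewrite mul_col_mx col_mxEd mxE.
  rewrite (bigID (mem T)) /= [X in _ + X]big1 ?addr0; last first.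
    by move=> i iT; rewrite r0 // mulr0.
  by rewrite (eq_bigr (fun i => r T i s * z i)) // => i _; rewrite mxE mulrC.
have /choice[kap kapP] : forall p : {set 'I_k} * 'I_k, exists w,
    p.1 \in F -> minorant a p.1 w /\ g w = c p.1 p.2.
  move=> p; have [/(cP _ p.2)[[w wm gw] _]|pF] := boolP (p.1 \in F).
    by exists w.
  by exists 0 => pF'; case/negP: pF.
pose top T := \sum_(i in T) cov i T.
pose J := [set p : {set 'I_k} * option 'I_k | p.1 \in F].
pose mk (p : {set 'I_k} * option 'I_k) :=
  if p.2 is Some s then kap (p.1, s) else neutral (top p.1).
pose tor (p : {set 'I_k} * option 'I_k) := if p.2 is Some s then d p.1 s else 1%N.
pose rr i (p : {set 'I_k} * option 'I_k) := if p.2 is Some s then r p.1 i s else 0.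
have mkm p : p \in J -> minorant a p.1 (mk p).
  rewrite inE; case: p => T [s|] /= TF; first by have [] := kapP (T, s) TF.
  move=> l lT; apply: alg_le_neutral (esym (neutralK regM _)) _.
  by apply: (alg_le_sum regM) => i iT; have [/(_ T) m _] := covP i; apply: m.
have mk_tor p : p \in J -> g (mk p) *+ tor p = 0.
  rewrite inE /mk /tor; case: p => T [s|] /= TF; last by rewrite g_neutral.
  by have [_ ->] := kapP (T, s) TF; have [] := cP T s TF.
pose o' := MarkedSum (fun j : 'I_#|J| => mk_tor _ (enum_valP j)).
pose S i (j : 'I_#|J|) := i \in (enum_val j).1.
pose rj i (j : 'I_#|J|) := rr i (enum_val j).
have dvd_rj i j : S i j -> ((@torsion o' j)%:Z %| (torsion i)%:Z * rj i j)%Z.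
  rewrite /= /rj; move: (enum_valP j); rewrite inE /rr /tor.
  case: (enum_val j) => T [s|] /= TF _; first exact: rP1.
  by rewrite mulr0 dvdz0.
have neutral_rj i : neutral (a i) = \sum_(j | S i j) neutral (@mark o' j).
  rewrite -raddf_sum; have -> : \sum_(j | S i j) @mark o' j =
      \sum_(p in J | i \in p.1) mk p by rewrite big_enum_val_cond.
  apply: neutral_anti; last first.
    by apply: (alg_le_sum regM) => p /andP[pJ ip]; apply: mkm pJ i ip.
  have [_ aE] := covP i; rewrite {1}aE; apply: (alg_le_sum regM) => T.
  rewrite inE => /andP[TF iT]; rewrite (bigD1 (T, None)) /=;
    last by rewrite in_set TF.
  apply: alg_le_trans (alg_le_addr _ _).
  apply: (@alg_le_trans _ _ (top T)); last exact: alg_le_addr.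
  by rewrite /top (bigD1 i) //=; apply: alg_le_addr.
have g_rj i : g (a i) = \sum_(j | S i j) g (@mark o' j) *~ rj i j.
  have -> : \sum_(j | S i j) g (@mark o' j) *~ rj i j =
      \sum_(p in J | i \in p.1) g (mk p) *~ rr i p by rewrite big_enum_val_cond.
  transitivity (\sum_(T in F | i \in T)
                  \sum_(q : option 'I_k) g (mk (T, q)) *~ rr i (T, q)).
    rewrite cE (bigID (fun T : {set 'I_k} => i \in T)) /= [X in _ + X]big1 ?addr0.
      apply: eq_bigr => T /andP[TF iT]; rewrite (bigD1 None) //= mulr0z add0r.
      rewrite (reindex_omap Some id) => [|[]//]; apply: eq_big => s.
        by rewrite eqxx.
      by move=> _; have [_ ->] := kapP (T, s) TF.
    by move=> T /andP[TF iT]; rewrite big1 // => s _; rewrite r0 // mulr0z.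
  rewrite pair_big_dep; apply: eq_big => [[T q]|[T q] _] //=.
  by rewrite [_ \in J]in_set andbT.
exists o', (matrix_map dvd_rj); split; first exact: matrix_map_eval.
apply/ffunP => j; rewrite !ffunE.
have jF : (enum_val j).1 \in F by move: (enum_valP j); rewrite inE.
have /eqP XYj : meets X (enum_val j).1 == meets Y (enum_val j).1.
  by move: jF; rewrite inE.
rewrite -[X in if X then _ else _]/(meets X _) XYj -/(meets Y _).
case: meets => //; congr Some; apply/residue_eq.
rewrite -sumrB (eq_bigr (fun i => rj i j * z i)) => [|i _]; last by rewrite mulrBr.
rewrite /S /rj /= /tor /rr; case: (enum_val j) jF => T [s|] /= TF; first exact: rP2.
by rewrite big1 ?dvdz0 // => i _; rewrite mul0r.
Qed.

End Kernel.

End Factorization.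
Theorem theorem6p6 (M : nmodType) :
  is_direct_limit_of finite_sum_of_basic M <->
  [/\ regular M, conical M, refinement M, emb M & pur M].
Proof.
rewrite pure_refinement_monoidP; split.
  move=> [disp [I [S [f [dirI basicS colimf]]]]].
  apply: (pure_refinement_colimit dirI colimf) => i.
  exact: pure_refinement_finite_sum_of_basic.
move=> [regM conM refM canM rootM].
have [G [g gP]] := grothendieck_group M.
apply: (direct_limit_criterion
    (phi := fun o : marked_sum g => eval regM canM gP o)
    (gens := fun o => @cyclic_gens _ (@torsion _ _ g o))).
- by move=> o M' h h'; apply: cyclic_gens_epi.
- exact: eval_surj.
- exact: eval_joint_factor.
- by move=> o x y; apply: eval_kernel_factor.
- by move=> o; apply: finite_sum_of_basic_cyclic_sum.
Qed.
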